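(* Let $0<\alpha<1$, $\sigma>0$, $N_1>1$ an integer, $h=\sigma^2\alpha^2$, $T=\sigma\alpha\sqrt{N_1}$, $\kappa=\frac{\alpha}{1-\alpha}$. For $x\in(0,1]$ and complex $u\notin(-\infty,0]$ let $$f(u,x)=\frac{\sin(\alpha\pi)}{\alpha\pi}\frac{1}{2\sqrt u}\frac{xe^{\sqrt u-T}}{e^{\frac1\alpha(\sqrt u-T)}+x}$$ (principal branch of $\sqrt u$), and for real $u$ define $$\hat f(u,x)=\begin{cases}f(u,x),&u\ge h,\\ f(h,x),&-h\le u\le h,\\ f(-u,x),&u\le -h.\end{cases}$$ Let $u^*=\frac{1+(1-2\alpha)\sqrt{4\alpha-4\alpha^2+1}}{2(1-\alpha)^2}$, $\gamma=\alpha\log\!\Big(\frac{\frac1\kappa\sqrt{u^*}+1}{\sqrt{u^*}-1}\Big)+\sqrt{u^*}$, $x^*=e^{\frac1\alpha(\gamma-T)}$, and $$M_0=2\max\left\{\frac{\sigma^2}{4},\ 1+\mathrm{ceil}\!\left(\frac{9\pi^2}{\sigma^2}\right),\ 2\,\mathrm{ceil}\!\left[\left(1+\sqrt{\tfrac{\pi}{\sigma}}\right)^4\right]\right\}.$$ Let $\Upsilon$ be the set of $x\in[x^*,1]$ with $(T+\alpha\log x)^2-\alpha^2\pi^2>M_0h$. Then for $x\in\Upsilon$, $$\sum_{n\ne0}\mathfrak{F}[\hat f]\Big(\frac{2n\pi}{h}\Big)=e^{h}\,\mathcal{O}(e^{-T})+\mathcal{O}\!\left(\frac{x^\alpha}{e^{\frac{2\pi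 a}{h}}-1}\right),\qquad a=2\pi\alpha(T+\alpha\log x),$$ where the constants in the $\mathcal{O}$ terms are independent of $T$, $n$, $h$, $x$, $\alpha$ and $\sigma$.
   Context: $\mathfrak{F}[w](\xi)=\int_{-\infty}^{+\infty}w(u)e^{-i\xi u}\,\mathrm{d}u$ is the Fourier transform in $u$ (for fixed $x$). $\mathrm{ceil}(y)$ is the least integer $\ge y$. Note $x^*=\frac{\frac1\kappa\sqrt{u^*}+1}{\sqrt{u^*}-1}e^{\frac1\alpha(\sqrt{u^*}-T)}$. *)

(* Defs.v *)
From Stdlib Require Import Reals ZArith.
From Coquelicot Require Import Coquelicot.
Open Scope R_scope.

(* ceil(y): least integer >= y  (Stdlib's [up y] is the least integer > y) *)
Definition Rceil (y : R) : R := IZR (1 - up (- y)).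

(* f(u,x); only evaluated at real u >= h > 0, where the principal branch of
   sqrt is the real square root *)
Definition f_ (al T u x : R) : R :=
  sin (al * PI) / (al * PI) * (1 / (2 * sqrt u)) *
  (x * exp (sqrt u - T) / (exp ((sqrt u - T) / al) + x)).

Definition fhat (al T h u x : R) : R :=
  if Rle_dec h u then f_ al T u x
  else if Rle_dec (- h) u then f_ al T h x
  else f_ al T (- u) x.

(* Fourier transform F[w](xi) = \int w(u) e^{-i xi u} du for real-valued w,
   written out as (real part, imaginary part) with improper integrals over R *)
Definition fourier_re (w : R -> R) (xi : R) : R :=
  RInt_gen (fun u => w u * cos (xi * u)) (Rbar_locally m_infty) (Rbar_locally p_infty).
Definition fourier_im (w : R -> R) (xi : R) : R :=
  - RInt_gen (fun u => w u * sin (xi * u)) (Rbar_locally m_infty) (Rbar_locally p_infty).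
Definition fourier (w : R -> R) (xi : R) : C := (fourier_re w xi, fourier_im w xi).

Definition fourier_exists (w : R -> R) (xi : R) : Prop :=
  ex_RInt_gen (fun u => w u * cos (xi * u)) (Rbar_locally m_infty) (Rbar_locally p_infty) /\
  ex_RInt_gen (fun u => w u * sin (xi * u)) (Rbar_locally m_infty) (Rbar_locally p_infty).

(* sum over n in Z \ {0} of g n converges (symmetric partial sums) to L *)
Definition sum_nonzero_is (g : Z -> C) (L : C) : Prop :=
  is_series (fun k : nat => fst (g (Z.of_nat (S k))) + fst (g (- Z.of_nat (S k))%Z)) (fst L) /\
  is_series (fun k : nat => snd (g (Z.of_nat (S k))) + snd (g (- Z.of_nat (S k))%Z)) (snd L).

Definition kappa (al : R) : R := al / (1 - al).
Definition u_star (al : R) : R :=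
  (1 + (1 - 2 * al) * sqrt (4 * al - 4 * al ^ 2 + 1)) / (2 * (1 - al) ^ 2).
Definition gamma_ (al : R) : R :=
  al * ln ((/ kappa al * sqrt (u_star al) + 1) / (sqrt (u_star al) - 1)) + sqrt (u_star al).
Definition x_star (al T : R) : R := exp (/ al * (gamma_ al - T)).

Definition M0 (sg : R) : R :=
  2 * Rmax (sg ^ 2 / 4)
        (Rmax (1 + Rceil (9 * PI ^ 2 / sg ^ 2))
              (2 * Rceil ((1 + sqrt (PI / sg)) ^ 4))).

(* Main.v *)
(** Put [L = (T + al ln x) / al], [q = 4 PI^2 L / sg^2 = 2 PI a / h] and
    [lam = 2 PI n / sg^2].  Since [2 n PI / h * h] is a multiple of [2 PI], the
    constant piece of [fhat] does not contribute, and the substitution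
    [u = (al s)^2] turns the [n]-th Fourier coefficient into a multiple of

      [int_sg^oo  Re (exp (al s + i lam s^2) / (1 + exp (s - L)))  ds].

    The integrand is holomorphic except for poles on the line [Re s = L], the
    lowest one being [L + i PI].  The half-line is pushed up to the V-shaped line
    [Im s = PI - PI / q + k |Re s - L|], [k = 2 PI (1 + 1 / sg)], which passes just
    below that pole.  There [Re (i lam s^2)] is at most [- n (q - 1)], with an
    extra linear decay away from the vertex that compensates the smallness of
    [1 + exp (s - L)] near the pole; this gives the term [x^al / (exp q - 1)]
    (for [sg < 1] it is absorbed by [exp (h - T)]).  The remaining vertical
    segment starts at [s = sg], where the integrand is real and its imaginary
    part is first order, which gives [exp (h - T) / n^2]. *)

Require Import Defs.
From Stdlib Require Import Reals ZArith Lra Lia.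
From Coquelicot Require Import Coquelicot.
Open Scope R_scope.

(** * Complex-valued functions of real variables *)

(** At [s + i y] the quadratic phase has modulus [exp (- 2 lam s y)], so the decay is governed by
    the product [s y]. On a horizontal line below the pole this product shrinks towards [s = sg] and
    the decay is lost; a slope of order [1 + 1 / sg] keeps it above its value at the vertex for all
    [s >= sg]. Stopping [PI / q] short of the pole costs a factor [exp n] in the numerator and one
    of order [k q] in the denominator. The arms have effective width of order
    [1 / (q (1 + 1 / sg))], which repays the [q] and the length element, so only [k] survives. No
    pole is crossed, hence no residue appears.

    Uniformity of the constants shapes the rest. At the starting segment a bound of order [1 / n]
    would not be summable, so the cancellation there is essential. The factor [al] coming from
    [sin (al PI)] must be kept: [sg] is unbounded and [exp h] controls only the product [al sg]. The
    conditions on [x] enter as [L >= 2 sg + 2] and [L >= sg^2 / 2]; the latter gives [q >= 18], so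
    that the geometric series in [exp (1 - q)] costs at most a factor 2. *)

Definition Cexp (z : C) : C := (exp (Re z) * cos (Im z), exp (Re z) * sin (Im z)).

Lemma Cmod_Cexp (z : C) : Cmod (Cexp z) = exp (Re z).
Proof.
  unfold Cmod, Cexp; simpl.
  replace (_ + _) with (exp (Re z) * exp (Re z) * (Rsqr (sin (Im z)) + Rsqr (cos (Im z))))
    by (unfold Rsqr; ring).
  rewrite sin2_cos2, Rmult_1_r.
  apply sqrt_square, Rlt_le, exp_pos.
Qed.

Lemma im_le_Cmod (z : C) : Rabs (Im z) <= Cmod z.
Proof. apply Rle_trans with (2 := Rmax_Cmod z), Rmax_r. Qed.

Lemma Cmod_le_plus (z w : C) : Cmod z - Cmod w <= Cmod (w + z).
Proof.
  pose proof (Cmod_triangle (w + z) (- w)) as H.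
  rewrite Cmod_opp in H.
  replace (w + z + - w)%C with z in H by ring. lra.
Qed.

Lemma norm2_neq_0 (z : C) : z <> 0 -> Re z ^ 2 + Im z ^ 2 <> 0.
Proof.
  intros Hz H; apply Hz.
  apply Cmod_eq_0. unfold Cmod.
  unfold Re, Im in H. rewrite H. apply sqrt_0.
Qed.

(** Derivatives are taken only along curves with a real parameter, so holomorphy can be used through
    the chain rule and everything reduces to real calculus on the two components. *)
Definition is_Cderive (z : R -> C) (t : R) (d : C) : Prop :=
  is_derive (fun u => Re (z u)) t (Re d) /\ is_derive (fun u => Im (z u)) t (Im d).

Lemma is_Cderive_const (c : C) (t : R) : is_Cderive (fun _ => c) t 0.
Proof. split; apply (is_derive_const (K := R_AbsRing) (V := R_NormedModule)). Qed.

Lemma is_Cderive_plus (z w : R -> C) (t : R) (dz dw : C) :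
  is_Cderive z t dz -> is_Cderive w t dw ->
  is_Cderive (fun u => z u + w u)%C t (dz + dw)%C.
Proof.
  intros [H1 H2] [H3 H4]; split.
  - apply (is_derive_plus (fun u => Re (z u)) (fun u => Re (w u)) t _ _ H1 H3).
  - apply (is_derive_plus (fun u => Im (z u)) (fun u => Im (w u)) t _ _ H2 H4).
Qed.

Lemma is_derive_Rmult (f g : R -> R) (t df dg : R) :
  is_derive f t df -> is_derive g t dg ->
  is_derive (fun u => f u * g u) t (df * g t + f t * dg).
Proof. intros H1 H2; apply (is_derive_mult f g t df dg H1 H2 Rmult_comm). Qed.

Lemma is_Cderive_mult (z w : R -> C) (t : R) (dz dw : C) :
  is_Cderive z t dz -> is_Cderive w t dw ->
  is_Cderive (fun u => z u * w u)%C t (dz * w t + z t * dw)%C.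
Proof.
  intros [H1 H2] [H3 H4]; split.
  - evar_last.
    + apply (is_derive_minus (fun u => Re (z u) * Re (w u)) (fun u => Im (z u) * Im (w u)));
        apply is_derive_Rmult; eassumption.
    + unfold minus, plus, opp, Cmult, Cplus, Re, Im; simpl. ring.
  - evar_last.
    + apply (is_derive_plus (fun u => Re (z u) * Im (w u)) (fun u => Im (z u) * Re (w u)));
        apply is_derive_Rmult; eassumption.
    + unfold minus, plus, opp, Cmult, Cplus, Re, Im; simpl. ring.
Qed.

Lemma is_Cderive_Cexp (z : R -> C) (t : R) (d : C) :
  is_Cderive z t d -> is_Cderive (fun u => Cexp (z u)) t (Cexp (z t) * d)%C.
Proof.
  intros [H1 H2].
  assert (He : is_derive (fun u => exp (Re (z u))) t (Re d * exp (Re (z t)))).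
  { apply (is_derive_comp exp (fun u => Re (z u)) t _ _ (is_derive_exp _) H1). }
  assert (Hc : is_derive (fun u => cos (Im (z u))) t (Im d * - sin (Im (z t)))).
  { apply (is_derive_comp cos (fun u => Im (z u)) t _ _ (is_derive_cos _) H2). }
  assert (Hs : is_derive (fun u => sin (Im (z u))) t (Im d * cos (Im (z t)))).
  { apply (is_derive_comp sin (fun u => Im (z u)) t _ _ (is_derive_sin _) H2). }
  split.
  - evar_last; [apply (is_derive_Rmult _ _ _ _ _ He Hc) |].
    unfold Cexp, Cmult, Re, Im; simpl. ring.
  - evar_last; [apply (is_derive_Rmult _ _ _ _ _ He Hs) |].
    unfold Cexp, Cmult, Re, Im; simpl. ring.
Qed.

Lemma is_Cderive_inv (z : R -> C) (t : R) (d : C) :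
  is_Cderive z t d -> z t <> 0 ->
  is_Cderive (fun u => / z u)%C t (- (d * (/ z t * / z t)))%C.
Proof.
  intros [H1 H2] Hz.
  pose proof (norm2_neq_0 _ Hz) as Hn.
  assert (Hq : is_derive (fun u => Re (z u) ^ 2 + Im (z u) ^ 2) t
                 (2 * Re (z t) * Re d + 2 * Im (z t) * Im d)).
  { apply (is_derive_ext (fun u => Re (z u) * Re (z u) + Im (z u) * Im (z u)));
      [intros u; simpl; ring |].
    evar_last.
    - apply (is_derive_plus (fun u => Re (z u) * Re (z u)) (fun u => Im (z u) * Im (z u)));
        apply is_derive_Rmult; eassumption.
    - unfold plus; simpl; ring. }
  split.
  - evar_last; [apply (is_derive_div (fun u => Re (z u)) _ t _ _ H1 Hq Hn) |].
    unfold Cmult, Cinv, Copp, Re, Im in *; simpl in *. field. now rewrite !Rmult_1_r in Hn.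
  - evar_last.
    + apply (is_derive_div (fun u => - Im (z u)) _ t _ _
               (is_derive_opp (fun u => Im (z u)) t _ H2) Hq Hn).
    + unfold Cmult, Cinv, Copp, opp, Re, Im in *; simpl in *. field. now rewrite !Rmult_1_r in Hn.
Qed.

(** Joint continuity in two real variables is what differentiation under the integral sign asks of
    the integrand's derivative. *)
Definition continuity_2d_C (g : R -> R -> C) (x y : R) : Prop :=
  continuity_2d_pt (fun u v => Re (g u v)) x y /\
  continuity_2d_pt (fun u v => Im (g u v)) x y.

Lemma continuity_2d_C_const (c : C) (x y : R) : continuity_2d_C (fun _ _ => c) x y.
Proof. split; apply continuity_2d_pt_const. Qed.

Lemma continuity_2d_C_plus (f g : R -> R -> C) (x y : R) :
  continuity_2d_C f x y -> continuity_2d_C g x y ->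
  continuity_2d_C (fun u v => f u v + g u v)%C x y.
Proof.
  intros [H1 H2] [H3 H4]; split.
  - apply (continuity_2d_pt_plus (fun u v => Re (f u v)) (fun u v => Re (g u v))); assumption.
  - apply (continuity_2d_pt_plus (fun u v => Im (f u v)) (fun u v => Im (g u v))); assumption.
Qed.

Lemma continuity_2d_C_opp (f : R -> R -> C) (x y : R) :
  continuity_2d_C f x y -> continuity_2d_C (fun u v => - f u v)%C x y.
Proof.
  intros [H1 H2]; split.
  - apply (continuity_2d_pt_opp (fun u v => Re (f u v))); assumption.
  - apply (continuity_2d_pt_opp (fun u v => Im (f u v))); assumption.
Qed.

Lemma continuity_2d_C_mult (f g : R -> R -> C) (x y : R) :
  continuity_2d_C f x y -> continuity_2d_C g x y ->
  continuity_2d_C (fun u v => f u v * g u v)%C x y.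
Proof.
  intros [H1 H2] [H3 H4]; split.
  - apply (continuity_2d_pt_minus (fun u v => Re (f u v) * Re (g u v))
             (fun u v => Im (f u v) * Im (g u v)));
      apply continuity_2d_pt_mult; assumption.
  - apply (continuity_2d_pt_plus (fun u v => Re (f u v) * Im (g u v))
             (fun u v => Im (f u v) * Re (g u v)));
      apply continuity_2d_pt_mult; assumption.
Qed.

Lemma continuity_2d_C_Cexp (f : R -> R -> C) (x y : R) :
  continuity_2d_C f x y -> continuity_2d_C (fun u v => Cexp (f u v)) x y.
Proof.
  intros [H1 H2]; split.
  - apply (continuity_2d_pt_mult (fun u v => exp (Re (f u v))) (fun u v => cos (Im (f u v)))).
    + apply (continuity_1d_2d_pt_comp exp (fun u v => Re (f u v))); [| assumption].
      apply derivable_continuous_pt, derivable_pt_exp.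
    + apply (continuity_1d_2d_pt_comp cos (fun u v => Im (f u v))); [| assumption].
      apply continuity_cos.
  - apply (continuity_2d_pt_mult (fun u v => exp (Re (f u v))) (fun u v => sin (Im (f u v)))).
    + apply (continuity_1d_2d_pt_comp exp (fun u v => Re (f u v))); [| assumption].
      apply derivable_continuous_pt, derivable_pt_exp.
    + apply (continuity_1d_2d_pt_comp sin (fun u v => Im (f u v))); [| assumption].
      apply continuity_sin.
Qed.

Lemma continuity_2d_C_inv (f : R -> R -> C) (x y : R) :
  continuity_2d_C f x y -> f x y <> 0 -> continuity_2d_C (fun u v => / f u v)%C x y.
Proof.
  intros [H1 H2] Hz.
  pose proof (norm2_neq_0 _ Hz) as Hn.
  assert (Hq : continuity_2d_pt (fun u v => / (Re (f u v) ^ 2 + Im (f u v) ^ 2)) x y).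
  { apply (continuity_2d_pt_inv (fun u v => Re (f u v) ^ 2 + Im (f u v) ^ 2)); [| exact Hn].
    apply (continuity_2d_pt_ext
             (fun u v => Re (f u v) * Re (f u v) + Im (f u v) * Im (f u v)));
      [intros u v; ring |].
    apply continuity_2d_pt_plus; apply continuity_2d_pt_mult; assumption. }
  split.
  - apply (continuity_2d_pt_mult (fun u v => Re (f u v))); assumption.
  - apply (continuity_2d_pt_mult (fun u v => - Im (f u v))); [| assumption].
    apply continuity_2d_pt_opp; assumption.
Qed.

Lemma continuity_2d_C_pair (f g : R -> R -> R) (x y : R) :
  continuity_2d_pt f x y -> continuity_2d_pt g x y ->
  continuity_2d_C (fun u v => (f u v, g u v)) x y.
Proof. intros H1 H2; split; assumption. Qed.

Lemma continuity_2d_pt_continuous_1 (f : R -> R -> R) (x y : R) :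
  continuity_2d_pt f x y -> continuous (fun u => f u y) x.
Proof.
  intros H. apply filterlim_locally; intros eps.
  destruct (H eps) as [d Hd].
  exists d; intros u Hu. apply Hd; [exact Hu |].
  rewrite Rminus_diag, Rabs_R0. apply cond_pos.
Qed.

Lemma continuity_2d_pt_continuous_2 (f : R -> R -> R) (x y : R) :
  continuity_2d_pt f x y -> continuous (fun v => f x v) y.
Proof.
  intros H. apply filterlim_locally; intros eps.
  destruct (H eps) as [d Hd].
  exists d; intros u Hu. apply Hd; [| exact Hu].
  rewrite Rminus_diag, Rabs_R0. apply cond_pos.
Qed.

(** * Deformation of a horizontal segment into a slanted one *)

(* [holo F F' D]: [F] has complex derivative [F'] on [D], with both continuous
   there, phrased through composition with curves and surfaces. *)
Record holo (F F' : C -> C) (D : C -> Prop) : Prop := {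
  holo_derive : forall z t d,
    is_Cderive z t d -> D (z t) -> is_Cderive (fun u => F (z u)) t (F' (z t) * d)%C;
  holo_cont : forall g x y,
    continuity_2d_C g x y -> D (g x y) -> continuity_2d_C (fun u v => F (g u v)) x y;
  holo_cont' : forall g x y,
    continuity_2d_C g x y -> D (g x y) -> continuity_2d_C (fun u v => F' (g u v)) x y }.

Section Deformation.

Variables (F F' : C -> C) (D : C -> Prop) (p m eps : R).
Hypothesis HF : holo F F' D.
Hypothesis Heps : 0 < eps.

Let tau (s : R) : R := p + m * s.

(** The margin [eps] around [0, 1] makes the derivatives in [th] at both ends of the homotopy
    two-sided. *)
Hypothesis HD : forall th s, - eps < th < 1 + eps -> D (s, th * tau s).

(** For the homotopy [z = s + i th tau(s)], [G] is the real part of [F(z) dz/ds] and [K] that of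
    [F(z) dz/dth]. The form [F(z) dz] is closed, so the [th]-derivative of [G] equals the
    [s]-derivative of [K]; [dG] is this common value. *)
Let G (th s : R) : R := Re (F (s, th * tau s) * (1, th * m)).
Let K (th s : R) : R := Re (F (s, th * tau s) * (0, tau s)).
Let dG (th s : R) : R :=
  Re (F' (s, th * tau s) * ((1, th * m) * (0, tau s)) + F (s, th * tau s) * (0, m)).

Lemma deform_is_derive_th (th s : R) :
  - eps < th < 1 + eps -> is_derive (fun u => G u s) th (dG th s).
Proof.
  intros Hth.
  assert (H1 : is_Cderive (fun u => F (s, u * tau s)) th (F' (s, (th * tau s)%R) * (0, tau s))%C).
  { apply (holo_derive _ _ _ HF (fun u => (s, u * tau s))); [| now apply HD].
    split; simpl; [apply (is_derive_const (K := R_AbsRing) (V := R_NormedModule)) |].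
    auto_derive; [trivial | ring]. }
  assert (H2 : is_Cderive (fun u => (1, u * m)) th (0, m)).
  { split; simpl; [apply (is_derive_const (K := R_AbsRing) (V := R_NormedModule)) |].
    auto_derive; [trivial | ring]. }
  destruct (is_Cderive_mult _ _ _ _ _ H1 H2) as [H _].
  evar_last; [exact H |].
  unfold dG. f_equal. ring.
Qed.

Lemma deform_is_derive_s (th s : R) :
  - eps < th < 1 + eps -> is_derive (fun u => K th u) s (dG th s).
Proof.
  intros Hth.
  assert (H1 : is_Cderive (fun u => F (u, th * tau u)) s (F' (s, (th * tau s)%R) * (1, th * m)%R)%C).
  { apply (holo_derive _ _ _ HF (fun u => (u, th * tau u))); [| now apply HD].
    unfold tau; split; simpl; auto_derive; trivial; ring. }
  assert (H2 : is_Cderive (fun u => (0, tau u)) s (0, m)).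
  { unfold tau; split; simpl; [apply (is_derive_const (K := R_AbsRing) (V := R_NormedModule)) |].
    auto_derive; [trivial | ring]. }
  destruct (is_Cderive_mult _ _ _ _ _ H1 H2) as [H _].
  evar_last; [exact H |].
  unfold dG. f_equal. ring.
Qed.

Let cont_th (th s : R) : continuity_2d_pt (fun th s => th * tau s) th s.
Proof.
  apply continuity_2d_pt_mult; [apply continuity_2d_pt_id1 |].
  apply continuity_2d_pt_plus; [apply continuity_2d_pt_const |].
  apply continuity_2d_pt_mult; [apply continuity_2d_pt_const | apply continuity_2d_pt_id2].
Qed.

Let cont_z (th s : R) : continuity_2d_C (fun th s => (s, th * tau s)) th s.
Proof.
  apply continuity_2d_C_pair; [apply continuity_2d_pt_id2 | apply cont_th].
Qed.

Let cont_i (th s : R) : continuity_2d_C (fun th s => (0, tau s)) th s.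
Proof.
  apply continuity_2d_C_pair; [apply continuity_2d_pt_const |].
  apply continuity_2d_pt_plus; [apply continuity_2d_pt_const |].
  apply continuity_2d_pt_mult; [apply continuity_2d_pt_const | apply continuity_2d_pt_id2].
Qed.

Let cont_1 (th s : R) : continuity_2d_C (fun th s => (1, th * m)) th s.
Proof.
  apply continuity_2d_C_pair; [apply continuity_2d_pt_const |].
  apply continuity_2d_pt_mult; [apply continuity_2d_pt_id1 | apply continuity_2d_pt_const].
Qed.

Lemma deform_continuity_dG (th s : R) :
  - eps < th < 1 + eps -> continuity_2d_pt dG th s.
Proof.
  intros Hth.
  apply (continuity_2d_C_plus
    (fun th s => F' (s, (th * tau s)%R) * ((1, (th * m)%R) * (0, tau s)))%C
    (fun th s => F (s, (th * tau s)%R) * (0, m))%C).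
  - apply continuity_2d_C_mult.
    + apply (holo_cont' _ _ _ HF); [apply cont_z | now apply HD].
    + apply continuity_2d_C_mult; [apply cont_1 | apply cont_i].
  - apply continuity_2d_C_mult; [| apply continuity_2d_C_const].
    apply (holo_cont _ _ _ HF); [apply cont_z | now apply HD].
Qed.

Lemma deform_continuity_G (th s : R) :
  - eps < th < 1 + eps -> continuity_2d_pt G th s.
Proof.
  intros Hth.
  apply (continuity_2d_C_mult (fun th s => F (s, (th * tau s)%R)) (fun th s => (1, th * m))).
  - apply (holo_cont _ _ _ HF); [apply cont_z | now apply HD].
  - apply cont_1.
Qed.

Lemma deform_continuity_K (th s : R) :
  - eps < th < 1 + eps -> continuity_2d_pt K th s.
Proof.
  intros Hth.
  apply (continuity_2d_C_mult (fun th s => F (s, (th * tau s)%R)) (fun th s => (0, tau s))).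
  - apply (holo_cont _ _ _ HF); [apply cont_z | now apply HD].
  - apply cont_i.
Qed.

Lemma deform_locally (th : R) (P : R -> Prop) :
  - eps < th < 1 + eps -> (forall u, - eps < u < 1 + eps -> P u) -> locally th P.
Proof.
  intros Hth H.
  assert (Hr : 0 < Rmin (th + eps) (1 + eps - th)) by (apply Rmin_pos; lra).
  exists (mkposreal _ Hr); intros u Hu; apply H.
  change (Rabs (u - th) < Rmin (th + eps) (1 + eps - th)) in Hu.
  apply Rabs_def2 in Hu.
  pose proof (Rmin_l (th + eps) (1 + eps - th)); pose proof (Rmin_r (th + eps) (1 + eps - th)).
  lra.
Qed.

(** Differentiating under the integral sign turns the integrand into an exact [s]-derivative, so
    only the boundary values of [K] remain. *)
Lemma deform_is_derive_RInt (a b th : R) :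
  - eps < th < 1 + eps ->
  is_derive (fun u => RInt (G u) a b) th (K th b - K th a).
Proof.
  intros Hth.
  assert (Hd : forall u v, - eps < u < 1 + eps -> Derive (fun z => G z v) u = dG u v).
  { intros u v Hu. apply is_derive_unique, deform_is_derive_th, Hu. }
  replace (K th b - K th a) with (RInt (fun t => Derive (fun u => G u t) th) a b).
  - apply is_derive_RInt_param.
    + apply (deform_locally th _ Hth); intros u Hu t _.
      exists (dG u t). now apply deform_is_derive_th.
    + intros t _. apply (continuity_2d_pt_ext_loc dG).
      * destruct (deform_locally th (fun u => - eps < u < 1 + eps) Hth ltac:(trivial)) as [d H].
        exists d; intros u v Hu _. symmetry; apply Hd. now apply H.
      * now apply deform_continuity_dG.
    + apply (deform_locally th _ Hth); intros u Hu.
      apply (ex_RInt_continuous (V := R_CompleteNormedModule)); intros t _.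
      now apply (continuity_2d_pt_continuous_2 G), deform_continuity_G.
  - rewrite (RInt_ext (V := R_CompleteNormedModule) _ (dG th)) by (intros; now apply Hd).
    apply is_RInt_unique.
    apply (is_RInt_derive (V := R_CompleteNormedModule) (K th)).
    + intros t _. now apply deform_is_derive_s.
    + intros t _. now apply (continuity_2d_pt_continuous_2 dG), deform_continuity_dG.
Qed.

(** Cauchy's theorem for a trapezoid with one side on the real axis, obtained by integrating the
    previous derivative over [th] from 0 to 1; the last two integrals are the vertical sides. *)
Lemma RInt_deform (a b : R) :
  RInt (fun s => Re (F (s, 0))) a b =
  RInt (fun s => Re (F (s, p + m * s) * (1, m))) a b
  + RInt (fun th => Re (F (a, th * (p + m * a)) * (0, p + m * a))) 0 1
  - RInt (fun th => Re (F (b, th * (p + m * b)) * (0, p + m * b))) 0 1.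
Proof.
  assert (Hex : forall s, ex_RInt (fun th => K th s) 0 1).
  { intros s. apply (ex_RInt_continuous (V := R_CompleteNormedModule)); intros t Ht.
    rewrite Rmin_left, Rmax_right in Ht by lra.
    apply (continuity_2d_pt_continuous_1 K), deform_continuity_K; lra. }
  assert (H : is_RInt (fun th => K th b - K th a) 0 1 (RInt (G 1) a b - RInt (G 0) a b)).
  { apply (is_RInt_derive (V := R_CompleteNormedModule) (fun u => RInt (G u) a b)).
    - intros t Ht. rewrite Rmin_left, Rmax_right in Ht by lra.
      apply deform_is_derive_RInt; lra.
    - intros t Ht. rewrite Rmin_left, Rmax_right in Ht by lra.
      apply (continuous_minus (V := R_NormedModule) (fun u => K u b) (fun u => K u a));
        apply (continuity_2d_pt_continuous_1 K), deform_continuity_K; lra. }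
  apply (is_RInt_unique (V := R_CompleteNormedModule)) in H.
  pose proof (RInt_minus (V := R_CompleteNormedModule) _ _ _ _ (Hex b) (Hex a)) as H'.
  unfold minus, plus, opp in H'; simpl in H'.
  unfold Rminus in H at 1. rewrite H' in H.
  assert (H0 : RInt (G 0) a b = RInt (fun s => Re (F (s, 0))) a b).
  { apply RInt_ext; intros s _. unfold G.
    rewrite !Rmult_0_l. f_equal. apply (Cmult_1_r (F (s, 0))). }
  assert (H1 : RInt (G 1) a b = RInt (fun s => Re (F (s, p + m * s) * (1, m))) a b).
  { apply RInt_ext; intros s _. unfold G, tau. now rewrite !Rmult_1_l. }
  rewrite <- H0, <- H1.
  unfold K, tau in H. lra.
Qed.

End Deformation.


(** * Elementary estimates *)

Lemma exp_ge_1_plus (t : R) : 1 + t <= exp t.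
Proof.
  destruct (Req_dec t 0) as [-> | H]; [rewrite exp_0; lra | now apply Rlt_le, exp_ineq1].
Qed.

Lemma exp_ge_square (t : R) : 0 <= t -> t ^ 2 / 4 <= exp t.
Proof.
  intros Ht.
  pose proof (exp_ge_1_plus (t / 2)) as H.
  replace (exp t) with (exp (t / 2) * exp (t / 2)) by (rewrite <- exp_plus; f_equal; lra).
  apply Rle_trans with ((1 + t / 2) * (1 + t / 2)); [nra |].
  apply Rmult_le_compat; lra.
Qed.

Lemma exp_le_compat (a b : R) : a <= b -> exp a <= exp b.
Proof. intros [H | ->]; [now apply Rlt_le, exp_increasing | lra]. Qed.

Lemma exp_neg_le_half (t : R) : 1 <= t -> exp (- t) <= / 2.
Proof.
  intros Ht. rewrite exp_Ropp.
  pose proof (exp_ge_1_plus t). apply Rinv_le_contravar; lra.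
Qed.

Lemma Rabs_sin_le (t : R) : Rabs (sin t) <= Rabs t.
Proof.
  assert (Hpos : forall u, 0 <= u -> - u <= sin u <= u).
  { intros u [Hu | <-]; [| rewrite sin_0; lra].
    pose proof (sin_lt_x u Hu) as H1. split; [| lra].
    destruct (Rle_dec 2 u); [pose proof (SIN_bound u); lra |].
    pose proof PI2_1.
    pose proof (sin_ge_0 u); lra. }
  destruct (Rle_dec 0 t) as [H | H].
  - rewrite (Rabs_right t) by lra. apply Rabs_le, Hpos, H.
  - rewrite (Rabs_left t) by lra. apply Rabs_le.
    pose proof (Hpos (- t)) as H'. rewrite sin_neg in H'. lra.
Qed.

Lemma half_le_sin (t : R) : 0 <= t <= 1 -> t / 2 <= sin t.
Proof.
  intros Ht. pose proof PI2_1.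
  pose proof (sin_bound t 0) as [H1 _]; try lra.
  unfold sin_approx, sin_term in H1; simpl in H1. nra.
Qed.

Lemma is_RInt_exp_affine (c d a b : R) :
  c <> 0 ->
  is_RInt (fun s => exp (c * s + d)) a b ((exp (c * b + d) - exp (c * a + d)) / c).
Proof.
  intros Hc.
  evar_last.
  - apply (is_RInt_derive (V := R_CompleteNormedModule) (fun s => exp (c * s + d) / c)).
    + intros x _. auto_derive; trivial. field; exact Hc.
    + intros x _. apply (ex_derive_continuous (V := R_NormedModule)). auto_derive; trivial.
  - unfold minus, plus, opp; simpl. field; exact Hc.
Qed.

Lemma RInt_abs_le_dominated (f g : R -> R) (a b I M : R) :
  a <= b -> (forall s, a <= s <= b -> continuous f s) ->
  is_RInt g a b I -> (forall s, a < s < b -> Rabs (f s) <= g s) -> I <= M ->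
  Rabs (RInt f a b) <= M.
Proof.
  intros Hab Hf Hg Hfg HI.
  assert (Hc : forall s, Rmin a b <= s <= Rmax a b -> continuous f s)
    by (rewrite Rmin_left, Rmax_right by exact Hab; exact Hf).
  apply Rle_trans with (2 := HI).
  apply Rle_trans with (RInt (fun s => Rabs (f s)) a b).
  - apply abs_RInt_le; [exact Hab |].
    now apply (ex_RInt_continuous (V := R_CompleteNormedModule)).
  - rewrite <- (is_RInt_unique (V := R_CompleteNormedModule) _ _ _ _ Hg).
    apply RInt_le; [exact Hab | | now exists I | exact Hfg].
    apply (ex_RInt_continuous (V := R_CompleteNormedModule)). intros s Hs.
    apply (continuous_comp f Rabs); [now apply Hc | apply continuous_Rabs].
Qed.

Lemma RInt_abs_le_exp_left (f : R -> R) (a b c B : R) :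
  a <= b -> 0 < c -> 0 <= B -> (forall s, a <= s <= b -> continuous f s) ->
  (forall s, a < s < b -> Rabs (f s) <= B * exp (- c * (s - a))) ->
  Rabs (RInt f a b) <= B / c.
Proof.
  intros Hab Hc HB Hf H.
  apply (RInt_abs_le_dominated f (fun s => B * exp (- c * s + c * a)) a b
           (B * ((exp (- c * b + c * a) - exp (- c * a + c * a)) / - c))); trivial.
  - apply (is_RInt_scal (V := R_NormedModule)), is_RInt_exp_affine; lra.
  - intros s Hs. replace (- c * s + c * a) with (- c * (s - a)) by ring. now apply H.
  - replace (- c * a + c * a) with 0 by ring. rewrite exp_0.
    pose proof (exp_pos (- c * b + c * a)).
    unfold Rdiv. apply Rmult_le_compat_l; [exact HB |].
    replace ((exp (- c * b + c * a) - 1) * / - c)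
      with (/ c - exp (- c * b + c * a) * / c) by (field; lra).
    assert (0 < / c) by (apply Rinv_0_lt_compat; lra). nra.
Qed.

(** The exponential of the minimum is one of two exponentials, decaying from 0 and from [b]. It is
    at most their sum, and each has integral at most [1 / c]. *)
Lemma RInt_abs_le_exp_min (f : R -> R) (a b c B : R) :
  0 <= a <= b -> 0 < c -> 0 <= B -> (forall s, a <= s <= b -> continuous f s) ->
  (forall s, a < s < b -> Rabs (f s) <= B * exp (- c * Rmin s (b - s))) ->
  Rabs (RInt f a b) <= 2 * B / c.
Proof.
  intros Hab Hc HB Hf H.
  apply (RInt_abs_le_dominated f
    (fun s => B * (exp (- c * s + 0) + exp (c * s + - (c * b)))) a b
    (B * ((exp (- c * b + 0) - exp (- c * a + 0)) / - c
          + (exp (c * b + - (c * b)) - exp (c * a + - (c * b))) / c))); try tauto.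
  - apply (is_RInt_scal (V := R_NormedModule)).
    apply (is_RInt_plus (V := R_NormedModule)); apply is_RInt_exp_affine; lra.
  - intros s Hs. apply Rle_trans with (1 := H s Hs).
    apply Rmult_le_compat_l; [exact HB |].
    pose proof (exp_pos (- c * s + 0)). pose proof (exp_pos (c * s + - (c * b))).
    unfold Rmin; destruct (Rle_dec s (b - s)).
    + rewrite Rplus_0_r in *. lra.
    + replace (- c * (b - s)) with (c * s + - (c * b)) by ring. lra.
  - replace (c * b + - (c * b)) with 0 by ring. rewrite exp_0.
    assert (0 <= c * a) by (apply Rmult_le_pos; lra).
    assert (exp (- c * a + 0) <= 1) by (rewrite <- exp_0; apply exp_le_compat; lra).
    pose proof (exp_pos (- c * b + 0)). pose proof (exp_pos (c * a + - (c * b))).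
    replace (2 * B / c) with (B * (2 * / c)) by (field; lra).
    apply Rmult_le_compat_l; [exact HB |].
    replace ((exp (- c * b + 0) - exp (- c * a + 0)) / - c +
             (1 - exp (c * a + - (c * b))) / c)
      with ((exp (- c * a + 0) - exp (- c * b + 0) + (1 - exp (c * a + - (c * b)))) * / c)
      by (field; lra).
    apply Rmult_le_compat_r; [apply Rlt_le, Rinv_0_lt_compat; lra | lra].
Qed.

(** * The oscillatory integrand *)

Section Integrand.

Variables (al lam L : R).

(** Its zeros are [L + i PI (2 j + 1)], the poles of [osc]. *)
Definition fermi (z : C) : C := (1 + Cexp (z + RtoC (- L)))%C.

Definition phase (z : C) : C := Cexp (RtoC al * z + (0, lam) * (z * z))%C.

Definition osc (z : C) : C := (phase z * / fermi z)%C.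

Definition osc' (z : C) : C :=
  (phase z * (RtoC al + (0, lam) * (z + z)) * / fermi z
   + phase z * - (Cexp (z + RtoC (- L)) * (/ fermi z * / fermi z)))%C.

Lemma is_Cderive_fermi (z : R -> C) (t : R) (d : C) :
  is_Cderive z t d -> is_Cderive (fun u => fermi (z u)) t (Cexp (z t + RtoC (- L)) * d)%C.
Proof.
  intros Hz.
  pose proof (is_Cderive_plus _ _ _ _ _ Hz (is_Cderive_const (RtoC (- L)) t)) as H1.
  apply is_Cderive_Cexp in H1.
  pose proof (is_Cderive_plus _ _ _ _ _ (is_Cderive_const 1 t) H1) as H2.
  unfold fermi.
  replace (Cexp (z t + RtoC (- L)) * d)%C
    with (0 + Cexp (z t + RtoC (- L)) * (d + 0))%C by ring.
  exact H2.
Qed.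

Lemma is_Cderive_phase (z : R -> C) (t : R) (d : C) :
  is_Cderive z t d ->
  is_Cderive (fun u => phase (z u)) t (phase (z t) * (RtoC al + (0, lam) * (z t + z t)) * d)%C.
Proof.
  intros Hz.
  pose proof (is_Cderive_mult _ _ _ _ _ (is_Cderive_const (RtoC al) t) Hz) as H1.
  pose proof (is_Cderive_mult _ _ _ _ _ (is_Cderive_const (0, lam) t)
                (is_Cderive_mult _ _ _ _ _ Hz Hz)) as H2.
  pose proof (is_Cderive_Cexp _ _ _ (is_Cderive_plus _ _ _ _ _ H1 H2)) as H3.
  replace (phase (z t) * (RtoC al + (0, lam) * (z t + z t)) * d)%C
    with (Cexp (RtoC al * z t + (0, lam) * (z t * z t)) *
            (0 * z t + RtoC al * d + (0 * (z t * z t) + (0, lam) * (d * z t + z t * d))))%C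
    by (unfold phase; ring).
  exact H3.
Qed.

Lemma holo_osc : holo osc osc' (fun z => fermi z <> 0).
Proof.
  assert (Hf : forall g x y, continuity_2d_C g x y ->
                 continuity_2d_C (fun u v => fermi (g u v)) x y).
  { intros g x y Hg. apply continuity_2d_C_plus; [apply continuity_2d_C_const |].
    apply continuity_2d_C_Cexp, continuity_2d_C_plus; [exact Hg | apply continuity_2d_C_const]. }
  assert (Hp : forall g x y, continuity_2d_C g x y ->
                 continuity_2d_C (fun u v => phase (g u v)) x y).
  { intros g x y Hg. apply continuity_2d_C_Cexp.
    apply continuity_2d_C_plus; apply continuity_2d_C_mult;
      try apply continuity_2d_C_const; try exact Hg.
    now apply continuity_2d_C_mult. }
  split.
  - intros z t d Hz HD.
    pose proof (is_Cderive_mult _ _ _ _ _ (is_Cderive_phase _ _ _ Hz)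
                  (is_Cderive_inv _ _ _ (is_Cderive_fermi _ _ _ Hz) HD)) as H.
    replace (osc' (z t) * d)%C with
      (phase (z t) * (RtoC al + (0, lam) * (z t + z t)) * d * / fermi (z t) +
       phase (z t) * - (Cexp (z t + RtoC (- L)) * d * (/ fermi (z t) * / fermi (z t))))%C
      by (unfold osc'; ring).
    exact H.
  - intros g x y Hg HD.
    apply continuity_2d_C_mult; [now apply Hp |].
    apply continuity_2d_C_inv; [now apply Hf | exact HD].
  - intros g x y Hg HD.
    assert (Hi : continuity_2d_C (fun u v => / fermi (g u v))%C x y)
      by (apply continuity_2d_C_inv; [now apply Hf | exact HD]).
    apply continuity_2d_C_plus; apply continuity_2d_C_mult;
      [| exact Hi | now apply Hp |].
    + apply continuity_2d_C_mult; [now apply Hp |].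
      apply continuity_2d_C_plus; [apply continuity_2d_C_const |].
      apply continuity_2d_C_mult; [apply continuity_2d_C_const |].
      now apply continuity_2d_C_plus.
    + apply continuity_2d_C_opp, continuity_2d_C_mult.
      * apply continuity_2d_C_Cexp, continuity_2d_C_plus;
          [exact Hg | apply continuity_2d_C_const].
      * now apply continuity_2d_C_mult.
Qed.

Lemma Re_osc_real (s : R) :
  Re (osc (s, 0)) = exp (al * s) / (1 + exp (s - L)) * cos (lam * s ^ 2).
Proof.
  unfold osc, phase, fermi.
  assert (E1 : (1 + Cexp ((s, 0%R) + RtoC (- L)))%C = RtoC (1 + exp (s - L))).
  { unfold Cexp, Cplus, RtoC, Re, Im; simpl.
    rewrite Rplus_0_l, sin_0, cos_0. f_equal; unfold Rminus; ring. }
  pose proof (exp_pos (s - L)).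
  rewrite E1, <- RtoC_inv by lra.
  unfold Cexp, Cmult, Cplus, RtoC, Re, Im; simpl.
  replace (al * s - 0 * 0 + (0 * (s * s - 0 * 0) - lam * (s * 0 + 0 * s))) with (al * s) by ring.
  replace (al * 0 + 0 * s + (0 * (s * 0 + 0 * s) + lam * (s * s - 0 * 0)))
    with (lam * (s * (s * 1))) by ring.
  field. lra.
Qed.

Lemma Cmod_phase (s y : R) : Cmod (phase (s, y)) = exp (al * s - 2 * lam * s * y).
Proof.
  unfold phase. rewrite Cmod_Cexp. f_equal.
  unfold Cmult, Cplus, RtoC, Re, Im; simpl. ring.
Qed.

Lemma Cmod_osc (s y : R) :
  fermi (s, y) <> 0 -> Cmod (osc (s, y)) = exp (al * s - 2 * lam * s * y) / Cmod (fermi (s, y)).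
Proof. intros H. unfold osc. now rewrite Cmod_mult, Cmod_inv, Cmod_phase. Qed.

Lemma Re_fermi (s y : R) : Re (fermi (s, y)) = 1 + exp (s - L) * cos y.
Proof.
  unfold fermi, Cexp, Cplus, RtoC, Re, Im; simpl. rewrite Rplus_0_r. reflexivity.
Qed.

Lemma Im_fermi (s y : R) : Im (fermi (s, y)) = exp (s - L) * sin y.
Proof.
  unfold fermi, Cexp, Cplus, RtoC, Re, Im; simpl. rewrite Rplus_0_r, Rplus_0_l. reflexivity.
Qed.

Lemma Cmod_Cexp_shift (s y : R) : Cmod (Cexp ((s, y) + RtoC (- L))) = exp (s - L).
Proof. rewrite Cmod_Cexp. reflexivity. Qed.

Lemma Cmod_fermi_ge_right (s y : R) : exp (s - L) - 1 <= Cmod (fermi (s, y)).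
Proof.
  rewrite <- (Cmod_Cexp_shift s y), <- Cmod_1 at 1. apply Cmod_le_plus.
Qed.

Lemma Cmod_fermi_ge_left (s y : R) : 1 - exp (s - L) <= Cmod (fermi (s, y)).
Proof.
  rewrite <- (Cmod_Cexp_shift s y), <- Cmod_1 at 1.
  unfold fermi. rewrite (Cplus_comm 1). apply Cmod_le_plus.
Qed.

(** Uniform in the height [y]: off the line [Re z = L] the two summands [1] and [exp (z - L)] differ
    in modulus. *)
Lemma Cmod_fermi_ge (s y : R) :
  Rabs (s - L) / (1 + Rabs (s - L)) <= Cmod (fermi (s, y)).
Proof.
  set (t := Rabs (s - L)).
  assert (Ht : 0 <= t) by apply Rabs_pos.
  assert (H1 : t / (1 + t) <= 1 - exp (- t)).
  { rewrite exp_Ropp. pose proof (exp_ge_1_plus t).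
    assert (/ exp t <= / (1 + t)) by (apply Rinv_le_contravar; lra).
    replace (t / (1 + t)) with (1 - / (1 + t)) by (field; lra). lra. }
  apply Rle_trans with (1 := H1). unfold t, Rabs; destruct (Rcase_abs (s - L)).
  - rewrite Ropp_involutive. apply Cmod_fermi_ge_left.
  - apply Rle_trans with (2 := Cmod_fermi_ge_right s y).
    assert (exp (s - L) * exp (- (s - L)) = 1)
      by (rewrite <- exp_plus, Rplus_opp_r; apply exp_0).
    pose proof (exp_ge_1_plus (s - L)). pose proof (exp_pos (- (s - L))). nra.
Qed.

(** Off [Re z = L] the moduli differ; on that line the imaginary part [sin y] vanishes for
    [|y| < PI] only at [y = 0], where the value is 2. *)
Lemma fermi_neq_0 (s y : R) : s <> L \/ Rabs y < PI -> fermi (s, y) <> 0.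
Proof.
  intros H.
  destruct (Req_dec s L) as [-> | Hs].
  - destruct H as [H | H]; [lra |].
    intros E.
    assert (Hr : Re (fermi (L, y)) = 0) by now rewrite E.
    assert (Hi : Im (fermi (L, y)) = 0) by now rewrite E.
    rewrite Re_fermi in Hr. rewrite Im_fermi in Hi.
    rewrite Rminus_diag, exp_0 in Hr, Hi.
    apply Rabs_def2 in H.
    destruct (Rtotal_order y 0) as [Hy | [-> | Hy]].
    + pose proof (sin_lt_0_var y). lra.
    + rewrite cos_0 in Hr. lra.
    + pose proof (sin_gt_0 y). lra.
  - apply Cmod_gt_0.
    apply Rlt_le_trans with (2 := Cmod_fermi_ge s y).
    assert (0 < Rabs (s - L)) by (apply Rabs_pos_lt; lra).
    apply Rdiv_lt_0_compat; lra.
Qed.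

(* The broken line [y = PI - d + k |s - L|] stays at distance of order [d / k]
   from the pole [L + i PI]. *)
Lemma Cmod_fermi_ge_broken_line (s d k : R) :
  0 < d <= 1 -> 1 <= k ->
  d / (8 * k) <= Cmod (fermi (s, PI - d + k * Rabs (s - L))).
Proof.
  intros Hd Hk.
  set (t := Rabs (s - L)).
  assert (Ht : 0 <= t) by apply Rabs_pos.
  assert (Hdk : 0 < d / k <= d).
  { split; [apply Rdiv_lt_0_compat; lra |].
    apply Rmult_le_reg_r with k; [lra |]. unfold Rdiv. rewrite Rmult_assoc, Rinv_l by lra. nra. }
  assert (Ed : d / k * k = d) by (field; lra).
  replace (d / (8 * k)) with (d / k / 8) by (field; lra).
  set (e := d / k) in *.
  destruct (Rle_dec (e / 2) t) as [H | H].
  (* Away from the vertex the horizontal distance to the pole suffices; within [e / 2] of it the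
     line is still at least [d / 2] below the pole, and the imaginary part gives the bound. *)
  - apply Rle_trans with (2 := Cmod_fermi_ge s _). fold t.
    apply Rle_trans with (t / (1 + t)); [| lra].
    apply Rmult_le_reg_r with (1 + t); [lra |].
    unfold Rdiv at 2. rewrite Rmult_assoc, Rinv_l by lra. nra.
  - apply Rle_trans with (2 := im_le_Cmod _).
    rewrite Im_fermi.
    replace (sin (PI - d + k * t)) with (sin (d - k * t))
      by (rewrite <- (sin_PI_x (d - k * t)); f_equal; ring).
    assert (Hkt : 0 <= k * t <= d / 2) by nra.
    assert (Hs : (d - k * t) / 2 <= sin (d - k * t)) by (apply half_le_sin; lra).
    assert (He : / 2 <= exp (s - L)).
    { pose proof (exp_ge_1_plus (s - L)).
      assert (- t <= s - L) by (unfold t, Rabs; destruct (Rcase_abs (s - L)); lra). lra. }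
    apply Rle_trans with (2 := Rle_abs _). nra.
Qed.

Lemma continuous_Re_osc (x0 x1 y0 y1 : R) (w : C) (u : R) :
  fermi (x0 + x1 * u, y0 + y1 * u) <> 0 ->
  continuous (fun v => Re (osc (x0 + x1 * v, y0 + y1 * v) * w)) u.
Proof.
  intros HD.
  assert (H : is_Cderive (fun v => (x0 + x1 * v, y0 + y1 * v)) u (x1, y1)).
  { split; simpl; auto_derive; trivial; ring. }
  apply (holo_derive _ _ _ holo_osc) in H; [| exact HD].
  pose proof (is_Cderive_mult _ _ _ _ _ H (is_Cderive_const w u)) as [H' _].
  apply (ex_derive_continuous (V := R_NormedModule)). eexists; exact H'.
Qed.

End Integrand.


(** * Estimates along the deformed contour *)

Lemma Rabs_Re_mult_le (z w : C) (A B : R) :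
  Cmod z <= A -> Cmod w <= B -> Rabs (Re (z * w)) <= A * B.
Proof.
  intros HA HB. apply Rle_trans with (1 := re_le_Cmod _).
  rewrite Cmod_mult. apply Rmult_le_compat; trivial; apply Cmod_ge_0.
Qed.

Lemma Cmod_le_Re_Im (x y : R) : Cmod (x, y) <= Rabs x + Rabs y.
Proof.
  replace (x, y) with (RtoC x + Ci * RtoC y)%C.
  - apply Rle_trans with (1 := Cmod_triangle _ _).
    rewrite Cmod_mult, Cmod_Ci, !Cmod_R. lra.
  - unfold Cplus, Cmult, Ci, RtoC; simpl. f_equal; ring.
Qed.

Lemma Cmod_osc_le (al lam L s y d : R) :
  0 < d -> d <= Cmod (fermi L (s, y)) ->
  Cmod (osc al lam L (s, y)) <= exp (al * s - 2 * lam * s * y) / d.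
Proof.
  intros Hd H. rewrite Cmod_osc by (apply Cmod_gt_0; lra).
  apply Rmult_le_compat_l; [apply Rlt_le, exp_pos | apply Rinv_le_contravar; lra].
Qed.

(** Here 18 is [4 * 9 / 2], from [PI^2 >= 9] and [L / sg^2 >= 1 / 2]. It makes the gap [PI / q] at
    most 1 and [exp (1 - q)] at most one half. *)
Lemma decay_rate_ge (sg L : R) :
  0 < sg -> sg ^ 2 / 2 <= L -> 18 <= 4 * PI ^ 2 * L / sg ^ 2.
Proof.
  intros Hsg HL.
  pose proof PI2_3_2 as Hpi.
  assert (Hsg2 : 0 < sg ^ 2) by (apply pow_lt, Hsg).
  apply Rmult_le_reg_r with (sg ^ 2); [exact Hsg2 |].
  unfold Rdiv. rewrite Rmult_assoc, Rinv_l by lra.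
  assert (9 <= PI ^ 2) by nra. nra.
Qed.

Section Contour.

Variables (al sg L : R) (N : nat).
Hypothesis Hal : 0 < al < 1.
Hypothesis Hsg : 0 < sg.
Hypothesis HL : 2 * sg + 2 <= L.
Hypothesis HL2 : sg ^ 2 / 2 <= L.
Hypothesis HN : (1 <= N)%nat.

Let lam := 2 * PI * INR N / sg ^ 2.
Let q := 4 * PI ^ 2 * L / sg ^ 2.
(** With this gap below the pole, the exponent [2 lam L (PI - d)] at the vertex is exactly
    [N (q - 1)]. *)
Let d := PI / q.
Let m := 1 + / sg.
Let k := 2 * PI * m.

Let N_ge_1 : 1 <= INR N.
Proof. apply (le_INR 1), HN. Qed.

Let PI_gt_3 : 3 < PI.
Proof. pose proof PI2_3_2. lra. Qed.

Let sg2_pos : 0 < sg ^ 2.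
Proof. apply pow_lt, Hsg. Qed.

Let lam_pos : 0 < lam.
Proof. unfold lam. apply Rdiv_lt_0_compat; [nra | exact sg2_pos]. Qed.

Let q_ge : 18 <= q := decay_rate_ge sg L Hsg HL2.

Let d_bound : 0 < d <= 1 /\ d < PI.
Proof.
  unfold d. pose proof PI_4. assert (0 < PI / q) by (apply Rdiv_lt_0_compat; lra).
  assert (PI / q * q = PI) by (field; lra). repeat split; nra.
Qed.

Let m_gt_1 : 1 < m.
Proof. unfold m. pose proof (Rinv_0_lt_compat _ Hsg). lra. Qed.

Let k_ge_1 : 1 <= k.
Proof. unfold k. nra. Qed.

Let cos_lam (y : R) : cos (al * y + lam * (sg ^ 2 - y ^ 2)) = cos (al * y - lam * y ^ 2).
Proof.
  replace (al * y + lam * (sg ^ 2 - y ^ 2)) with (al * y - lam * y ^ 2 + 2 * INR N * PI)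
    by (unfold lam; field; lra).
  apply cos_period.
Qed.

Let sin_lam (y : R) : sin (al * y + lam * (sg ^ 2 - y ^ 2)) = sin (al * y - lam * y ^ 2).
Proof.
  replace (al * y + lam * (sg ^ 2 - y ^ 2)) with (al * y - lam * y ^ 2 + 2 * INR N * PI)
    by (unfold lam; field; lra).
  apply sin_period.
Qed.

(* [lam * sg^2] is a multiple of [2 PI], so [osc] is real at [sg] and its
   imaginary part is first order in [y] on the vertical line through [sg]. *)
Lemma Im_osc_start_le (y : R) :
  0 <= y ->
  Rabs (Im (osc al lam L (sg, y))) <=
  exp (al * sg - 2 * lam * sg * y) * (2 * (al * y + lam * y ^ 2) + 4 * exp (sg - L) * y).
Proof.
  intros Hy.
  assert (He : exp (sg - L) <= / 2).
  { replace (sg - L) with (- (L - sg)) by ring. apply exp_neg_le_half; lra. }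
  pose proof (exp_pos (sg - L)) as He0.
  assert (HQ : / 2 <= Cmod (fermi L (sg, y)))
    by (pose proof (Cmod_fermi_ge_left L sg y); lra).
  assert (HQ0 : fermi L (sg, y) <> 0) by (apply Cmod_gt_0; lra).
  assert (HP : Cmod (/ fermi L (sg, y)) <= 2).
  { rewrite Cmod_inv by exact HQ0.
    rewrite <- (Rinv_inv 2). apply Rinv_le_contravar; lra. }
  assert (HIP : Rabs (Im (/ fermi L (sg, y))%C) <= 4 * exp (sg - L) * y).
  { assert (Hn : / 4 <= Re (fermi L (sg, y)) ^ 2 + Im (fermi L (sg, y)) ^ 2).
    { rewrite <- Cmod2_alt. nra. }
    change (Im (/ fermi L (sg, y))%C)
      with (- Im (fermi L (sg, y)) / (Re (fermi L (sg, y)) ^ 2 + Im (fermi L (sg, y)) ^ 2)).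
    set (n2 := Re (fermi L (sg, y)) ^ 2 + Im (fermi L (sg, y)) ^ 2) in *.
    unfold Rdiv. rewrite Rabs_mult, Rabs_Ropp, Rabs_inv, (Rabs_right n2) by lra.
    assert (/ n2 <= 4) by (rewrite <- (Rinv_inv 4); apply Rinv_le_contravar; lra).
    assert (0 < / n2) by (apply Rinv_0_lt_compat; lra).
    rewrite Im_fermi, Rabs_mult, (Rabs_right (exp _)) by lra.
    pose proof (Rabs_sin_le y) as Hs. rewrite (Rabs_right y) in Hs by lra.
    pose proof (Rabs_pos (sin y)).
    replace (4 * exp (sg - L) * y) with (exp (sg - L) * y * 4) by ring.
    apply Rmult_le_compat; [nra | lra | nra | lra]. }
  set (P := (/ fermi L (sg, y))%C) in *.
  replace (Im (osc al lam L (sg, y))) with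
    (exp (al * sg - 2 * lam * sg * y) *
       (cos (al * y - lam * y ^ 2) * Im P + sin (al * y - lam * y ^ 2) * Re P)).
  - rewrite Rabs_mult, (Rabs_right (exp _)) by (apply Rle_ge, Rlt_le, exp_pos).
    apply Rmult_le_compat_l; [apply Rlt_le, exp_pos |].
    apply Rle_trans with (1 := Rabs_triang _ _).
    rewrite !Rabs_mult.
    pose proof (Rabs_sin_le (al * y - lam * y ^ 2)) as Hs.
    assert (Hpsi : Rabs (al * y - lam * y ^ 2) <= al * y + lam * y ^ 2).
    { assert (0 <= al * y) by nra. assert (0 <= lam * y ^ 2) by nra.
      apply Rabs_le; lra. }
    assert (Hc : Rabs (cos (al * y - lam * y ^ 2)) <= 1).
    { apply Rabs_le, COS_bound. }
    pose proof (re_le_Cmod P). pose proof (Rabs_pos (Re P)). pose proof (Rabs_pos (Im P)).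
    pose proof (Rabs_pos (sin (al * y - lam * y ^ 2))).
    assert (Rabs (sin (al * y - lam * y ^ 2)) * Rabs (Re P) <= (al * y + lam * y ^ 2) * 2)
      by (apply Rmult_le_compat; lra).
    nra.
  - unfold osc. fold P. rewrite <- cos_lam, <- sin_lam.
    unfold phase, Cexp, Cmult, Cplus, RtoC, Re, Im; simpl.
    replace (al * sg - 0 * y + (0 * (sg * sg - y * y) - lam * (sg * y + y * sg)))
      with (al * sg - 2 * lam * sg * y) by ring.
    replace (al * y + 0 * sg + (0 * (sg * y + y * sg) + lam * (sg * sg - y * y)))
      with (al * y + lam * (sg * (sg * 1) - y * (y * 1))) by ring.
    ring.
Qed.

Let fermi_start (y : R) : fermi L (sg, y) <> 0.
Proof. apply fermi_neq_0; left; lra. Qed.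

(** The decay rate in the height [y] is [c = 4 PI N / sg]. Integrating a term linear in [y] gives
    [1 / c^2], and [lam y^2] gives [lam / c^3]; both are of order [1 / N^2], uniformly in the length
    [Y]. *)
Lemma vertical_start_le (Y : R) :
  0 < Y ->
  Rabs (RInt (fun th => Re (osc al lam L (sg, th * Y) * (0, Y))) 0 1) <=
  exp (al * sg) * (al * sg ^ 2 + sg ^ 2 * exp (sg - L) + sg) / INR N ^ 2.
Proof.
  intros HY.
  set (c := 2 * lam * sg).
  assert (Hc : 0 < c) by (unfold c; nra).
  set (e := exp (sg - L)). assert (He : 0 < e) by apply exp_pos.
  set (B := Y * exp (al * sg) * ((2 * al + 4 * e) * (2 / c) + 32 * lam / c ^ 2)).
  assert (Hi : 0 < / c) by (apply Rinv_0_lt_compat; exact Hc).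
  assert (Hi2 : 0 < / c ^ 2) by (apply Rinv_0_lt_compat, pow_lt, Hc).
  assert (HB : 0 <= B).
  { unfold B, Rdiv. pose proof (exp_pos (al * sg)).
    assert (0 <= (2 * al + 4 * e) * (2 * / c) + 32 * lam * / c ^ 2) by nra.
    assert (0 < Y * exp (al * sg)) by nra. nra. }
  apply Rle_trans with (B / (c * Y / 2)).
  - apply RInt_abs_le_exp_left; [lra | nra | exact HB | |].
    + intros s _.
      apply (continuous_ext (fun u => Re (osc al lam L (sg + 0 * u, 0 + Y * u) * (0, Y)))).
      * intros u. now replace (sg + 0 * u) with sg by ring; replace (0 + Y * u) with (u * Y) by ring.
      * apply continuous_Re_osc. rewrite Rmult_0_l, Rplus_0_r. apply fermi_start.
    + intros th Hth. set (y := th * Y).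
      assert (Hy : 0 <= y) by (unfold y; nra).
      replace (Re (osc al lam L (sg, y) * (0, Y))) with (- (Y * Im (osc al lam L (sg, y))))
        by (unfold Cmult, Re, Im; simpl; ring).
      rewrite Rabs_Ropp, Rabs_mult, (Rabs_right Y) by lra.
      unfold B. rewrite !Rmult_assoc. apply Rmult_le_compat_l; [lra |].
      apply Rle_trans with (1 := Im_osc_start_le y Hy). fold e.
      replace (al * sg - 2 * lam * sg * y) with (al * sg + - (c * y)) by (unfold c; ring).
      rewrite exp_plus, Rmult_assoc. apply Rmult_le_compat_l; [apply Rlt_le, exp_pos |].
      replace (- (c * Y / 2) * (th - 0)) with (- (c * y / 2)) by (unfold y; field).
      (* Half of the exponential decay absorbs the factors [y] and [y^2]; the other half is left to
         be integrated. *)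
      set (E := exp (c * y / 2)).
      assert (HE : exp (- (c * y)) = exp (- (c * y / 2)) * / E).
      { unfold E. rewrite <- exp_Ropp, <- exp_plus. f_equal. field. }
      rewrite HE, Rmult_assoc, (Rmult_comm _ (exp (- (c * y / 2)))).
      apply Rmult_le_compat_l; [apply Rlt_le, exp_pos |].
      assert (HE0 : 0 < E) by apply exp_pos.
      assert (Hcy : 0 <= c * y / 2) by nra.
      assert (E1 : y <= 2 / c * E).
      { pose proof (exp_ge_1_plus (c * y / 2)) as H. fold E in H.
        replace y with (2 / c * (c * y / 2)) at 1 by (field; lra).
        apply Rmult_le_compat_l; [unfold Rdiv; nra | lra]. }
      assert (E2 : y ^ 2 <= 16 / c ^ 2 * E).
      { pose proof (exp_ge_square (c * y / 2) Hcy) as H. fold E in H.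
        replace (y ^ 2) with (16 / c ^ 2 * ((c * y / 2) ^ 2 / 4)) by (field; lra).
        apply Rmult_le_compat_l; [unfold Rdiv; nra | lra]. }
      apply Rmult_le_reg_l with E; [exact HE0 |].
      rewrite <- Rmult_assoc, Rinv_r, Rmult_1_l by lra.
      replace (E * ((2 * al + 4 * e) * (2 / c) + 32 * lam / c ^ 2))
        with ((2 * al + 4 * e) * (2 / c * E) + 2 * lam * (16 / c ^ 2 * E)) by (field; lra).
      replace (2 * (al * y + lam * y ^ 2) + 4 * e * y)
        with ((2 * al + 4 * e) * y + 2 * lam * y ^ 2) by ring.
      apply Rplus_le_compat; apply Rmult_le_compat_l; lra.
  - replace (B / (c * Y / 2)) with
      (exp (al * sg) * (((al + 2 * e) * sg ^ 2 + 4 * sg) / (2 * PI ^ 2)) / INR N ^ 2).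
    + apply Rmult_le_compat_r.
      { apply Rlt_le, Rinv_0_lt_compat, pow_lt; lra. }
      apply Rmult_le_compat_l; [apply Rlt_le, exp_pos |].
      apply Rmult_le_reg_r with (2 * PI ^ 2); [nra |].
      unfold Rdiv at 1. rewrite Rmult_assoc, Rinv_l by nra.
      assert (9 <= PI ^ 2) by nra.
      assert (0 <= sg ^ 2 * e) by nra. assert (0 <= al * sg ^ 2) by nra. nra.
    + unfold B, c, lam. field. repeat split; lra.
Qed.

(** Since [al < 1], the quotient [exp (al b) / exp (b - L)] is at most [exp L]; integrating
    [exp (- 2 lam b y)] over the height supplies the [1 / b] that removes this segment in the
    limit. *)
Lemma vertical_end_le (b Y : R) :
  L + 1 <= b -> 0 < Y ->
  Rabs (RInt (fun th => Re (osc al lam L (b, th * Y) * (0, Y))) 0 1) <= exp L / lam / b.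
Proof.
  intros Hb HY.
  assert (Hlb : 0 < lam * b) by nra.
  replace (exp L / lam / b) with (Y * (2 * exp L) / (2 * lam * b * Y)) by (field; lra).
  pose proof (exp_pos L).
  apply RInt_abs_le_exp_left; [lra | nra | nra | |].
  - intros s _.
    apply (continuous_ext (fun u => Re (osc al lam L (b + 0 * u, 0 + Y * u) * (0, Y)))).
    + intros u. now replace (b + 0 * u) with b by ring; replace (0 + Y * u) with (u * Y) by ring.
    + apply continuous_Re_osc. rewrite Rmult_0_l, Rplus_0_r. apply fermi_neq_0; left; lra.
  - intros th Hth.
    assert (Hf : exp (b - L) / 2 <= Cmod (fermi L (b, th * Y))).
    { pose proof (Cmod_fermi_ge_right L b (th * Y)). pose proof (exp_ge_1_plus (b - L)). lra. }
    pose proof (exp_pos (b - L)).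
    apply Rle_trans with (exp (al * b - 2 * lam * b * (th * Y)) / (exp (b - L) / 2) * Y).
    + apply Rabs_Re_mult_le; [apply Cmod_osc_le; [lra | exact Hf] |].
      apply Rle_trans with (1 := Cmod_le_Re_Im _ _). rewrite Rabs_R0, Rabs_right; lra.
    + replace (exp (al * b - 2 * lam * b * (th * Y)) / (exp (b - L) / 2) * Y)
        with (Y * 2 * (exp (al * b - 2 * lam * b * (th * Y)) * exp (- (b - L))))
        by (rewrite exp_Ropp; field; lra).
      rewrite <- !exp_plus, !Rmult_assoc. apply Rmult_le_compat_l; [lra |].
      apply Rmult_le_compat_l; [lra |]. rewrite <- exp_plus. apply exp_le_compat. nra.
Qed.

Let twice_lam : 2 * lam = INR N * q / (PI * L).
Proof. unfold lam, q. field. repeat split; lra. Qed.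

(* On the broken line [s * y] exceeds its value [L * (PI - d)] at the vertex by
   an amount linear in the distance to the vertex (or to 0), which pays for the
   proximity of the pole. *)
Lemma exponent_left_le (s : R) :
  sg <= s <= L ->
  al * s - 2 * lam * s * (PI - d + k * (L - s)) <=
  al * L - INR N * (q - 1) - q * m / 2 * Rmin s (L - s).
Proof.
  intros Hs. rewrite twice_lam.
  set (r := Rmin s (L - s)).
  (* This inequality is the reason for the summand [/ sg] in [m]: the height gained by moving left
     must outweigh the loss in [s], down to [s = sg]. *)
  assert (Hsm : 1 <= s * m).
  { unfold m. apply Rle_trans with (sg * (1 + / sg)).
    - rewrite Rmult_plus_distr_l, Rinv_r; lra.
    - apply Rmult_le_compat_r; [unfold m in m_gt_1; lra | lra]. }
  assert (H1 : L * (PI - d) + PI * ((L - s) * s * m) <= s * (PI - d + k * (L - s))).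
  { apply Rminus_le_0.
    replace (s * (PI - d + k * (L - s)) - (L * (PI - d) + PI * ((L - s) * s * m)))
      with ((L - s) * (PI * (s * m - 1) + d)) by (unfold k; ring).
    apply Rmult_le_pos; [lra |]. nra. }
  (* The larger of [s] and [L - s] is at least [L / 2]. *)
  assert (H2 : r / 2 <= (L - s) * s / L).
  { apply Rmult_le_reg_r with L; [lra |].
    unfold Rdiv at 2. rewrite Rmult_assoc, Rinv_l by lra.
    unfold r, Rmin; destruct (Rle_dec s (L - s)); nra. }
  assert (Hr : 0 <= r) by (unfold r; apply Rmin_glb; lra).
  assert (HW : 0 < INR N * q / (PI * L)).
  { apply Rdiv_lt_0_compat; nra. }
  apply Rmult_le_compat_l with (r := INR N * q / (PI * L)) in H1; [| lra].
  replace (INR N * q / (PI * L) * (L * (PI - d) + PI * ((L - s) * s * m)))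
    with (INR N * (q - 1) + INR N * (q * m * ((L - s) * s / L))) in H1
    by (unfold d; field; lra).
  assert (H3 : q * m / 2 * r <= INR N * (q * m * ((L - s) * s / L))).
  { assert (0 < q * m) by nra.
    assert (q * m * (r / 2) <= q * m * ((L - s) * s / L)) by (apply Rmult_le_compat_l; lra).
    assert (0 <= q * m * (r / 2)) by nra. nra. }
  assert (al * s <= al * L) by nra.
  rewrite Rmult_assoc. lra.
Qed.

(** The slope gains [2 q m (s - L)] in the exponent; half of it pays for the growth of [al s] beyond
    [al L], which is at most [s - L]. *)
Lemma exponent_right_le (s : R) :
  L <= s ->
  al * s - 2 * lam * s * (PI - d + k * (s - L)) <=
  al * L - INR N * (q - 1) - q * m * (s - L).
Proof.
  intros Hs. rewrite twice_lam.
  assert (H1 : L * (PI - d) + (s - L) * k * L <= s * (PI - d + k * (s - L))).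
  { apply Rminus_le_0.
    replace (s * (PI - d + k * (s - L)) - (L * (PI - d) + (s - L) * k * L))
      with ((s - L) * (PI - d + k * (s - L))) by ring.
    apply Rmult_le_pos; [lra |]. assert (0 <= k * (s - L)) by nra. lra. }
  assert (HW : 0 < INR N * q / (PI * L)).
  { apply Rdiv_lt_0_compat; nra. }
  apply Rmult_le_compat_l with (r := INR N * q / (PI * L)) in H1; [| lra].
  replace (INR N * q / (PI * L) * (L * (PI - d) + (s - L) * k * L))
    with (INR N * (q - 1) + INR N * (2 * (q * m * (s - L)))) in H1
    by (unfold d, k; field; lra).
  assert (Hqm : 1 <= q * m) by nra.
  assert (H0 : s - L <= q * m * (s - L)) by nra.
  assert (al * s <= al * L + (s - L)) by nra.
  assert (2 * (q * m * (s - L)) <= INR N * (2 * (q * m * (s - L)))) by nra.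
  rewrite Rmult_assoc. lra.
Qed.

Lemma Cmod_osc_broken_line_le (s y e : R) :
  y = PI - d + k * Rabs (s - L) ->
  al * s - 2 * lam * s * y <= e ->
  Cmod (osc al lam L (s, y)) <= 8 * k * q / PI * exp e.
Proof.
  intros -> He.
  apply Rle_trans with (exp e / (d / (8 * k))).
  - destruct d_bound as [Hd _].
    assert (0 < d / (8 * k)) by (apply Rdiv_lt_0_compat; lra).
    apply Rle_trans with (1 := Cmod_osc_le al lam L s _ (d / (8 * k)) ltac:(assumption)
      (Cmod_fermi_ge_broken_line L s d k Hd k_ge_1)).
    apply Rmult_le_compat_r; [apply Rlt_le, Rinv_0_lt_compat; lra |].
    now apply exp_le_compat.
  - right. unfold d. field. lra.
Qed.

Let fermi_line (s y : R) : y = PI - d + k * Rabs (s - L) -> fermi L (s, y) <> 0.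
Proof.
  intros ->. apply Cmod_gt_0. destruct d_bound as [Hd _].
  apply Rlt_le_trans with (2 := Cmod_fermi_ge_broken_line L s d k Hd k_ge_1).
  apply Rdiv_lt_0_compat; lra.
Qed.

Let Cmod_slope (t : R) : Rabs t = k -> Cmod (1, t) <= (2 * PI + 1) * m.
Proof.
  intros Ht. apply Rle_trans with (1 := Cmod_le_Re_Im _ _).
  rewrite Rabs_R1, Ht. unfold k. lra.
Qed.

(** The denominator near the pole costs [8 k q / PI], the slope [(2 PI + 1) m], and integration
    gains [4 / (q m)]. Thus [q] and [m] cancel and leave [(64 + 32 / PI) k], below [75 k]. *)
Lemma line_left_le :
  Rabs (RInt (fun s => Re (osc al lam L (s, PI - d + k * L + - k * s) * (1, - k))) sg L)
  <= 75 * k * exp (al * L - INR N * (q - 1)).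
Proof.
  set (E := exp (al * L - INR N * (q - 1))). assert (HE : 0 < E) by apply exp_pos.
  set (B := 8 * k * q / PI * E * ((2 * PI + 1) * m)).
  assert (HB : 0 <= B).
  { unfold B. assert (0 < 8 * k * q / PI) by (apply Rdiv_lt_0_compat; nra).
    apply Rmult_le_pos; nra. }
  apply Rle_trans with (2 * B / (q * m / 2)).
  - apply RInt_abs_le_exp_min; [lra | nra | exact HB | |].
    + intros s Hs.
      apply (continuous_ext
        (fun u => Re (osc al lam L (0 + 1 * u, PI - d + k * L + - k * u) * (1, - k)))).
      * intros u. now rewrite Rmult_1_l, Rplus_0_l.
      * apply continuous_Re_osc. replace (0 + 1 * s) with s by ring.
        apply fermi_line. rewrite Rabs_left1 by lra. ring.
    + intros s Hs.
      replace (B * exp (- (q * m / 2) * Rmin s (L - s))) with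
        (8 * k * q / PI * exp (al * L - INR N * (q - 1) - q * m / 2 * Rmin s (L - s))
           * ((2 * PI + 1) * m)).
      * apply Rabs_Re_mult_le.
        -- apply Cmod_osc_broken_line_le; [rewrite Rabs_left1 by lra; ring |].
           replace (PI - d + k * L + - k * s) with (PI - d + k * (L - s)) by ring.
           apply exponent_left_le; lra.
        -- apply Cmod_slope. rewrite Rabs_Ropp, Rabs_right; lra.
      * unfold B, E.
        replace (al * L - INR N * (q - 1) - q * m / 2 * Rmin s (L - s))
          with (al * L - INR N * (q - 1) + - (q * m / 2) * Rmin s (L - s)) by ring.
        rewrite exp_plus. ring.
  - replace (2 * B / (q * m / 2)) with ((64 + 32 / PI) * (k * E)).
    + replace (75 * k * E) with (75 * (k * E)) by ring.
      apply Rmult_le_compat_r; [nra |].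
      assert (/ PI <= / 3) by (apply Rinv_le_contravar; lra).
      unfold Rdiv. lra.
    + unfold B. field. lra.
Qed.

Lemma line_right_le (b : R) :
  L <= b ->
  Rabs (RInt (fun s => Re (osc al lam L (s, PI - d - k * L + k * s) * (1, k))) L b)
  <= 25 * k * exp (al * L - INR N * (q - 1)).
Proof.
  intros Hb.
  set (E := exp (al * L - INR N * (q - 1))). assert (HE : 0 < E) by apply exp_pos.
  set (B := 8 * k * q / PI * E * ((2 * PI + 1) * m)).
  assert (HB : 0 <= B).
  { unfold B. assert (0 < 8 * k * q / PI) by (apply Rdiv_lt_0_compat; nra).
    apply Rmult_le_pos; nra. }
  apply Rle_trans with (B / (q * m)).
  - apply RInt_abs_le_exp_left; [lra | nra | exact HB | |].
    + intros s Hs.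
      apply (continuous_ext
        (fun u => Re (osc al lam L (0 + 1 * u, PI - d - k * L + k * u) * (1, k)))).
      * intros u. now rewrite Rmult_1_l, Rplus_0_l.
      * apply continuous_Re_osc. replace (0 + 1 * s) with s by ring.
        apply fermi_line. rewrite Rabs_right by lra. ring.
    + intros s Hs.
      replace (B * exp (- (q * m) * (s - L))) with
        (8 * k * q / PI * exp (al * L - INR N * (q - 1) - q * m * (s - L))
           * ((2 * PI + 1) * m)).
      * apply Rabs_Re_mult_le.
        -- apply Cmod_osc_broken_line_le; [rewrite Rabs_right by lra; ring |].
           replace (PI - d - k * L + k * s) with (PI - d + k * (s - L)) by ring.
           apply exponent_right_le; lra.
        -- apply Cmod_slope. rewrite Rabs_right; lra.
      * unfold B, E.
        replace (al * L - INR N * (q - 1) - q * m * (s - L))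
          with (al * L - INR N * (q - 1) + - (q * m) * (s - L)) by ring.
        rewrite exp_plus. ring.
  - replace (B / (q * m)) with ((16 + 8 / PI) * (k * E)).
    + replace (25 * k * E) with (25 * (k * E)) by ring.
      apply Rmult_le_compat_r; [nra |].
      assert (/ PI <= / 3) by (apply Rinv_le_contravar; lra).
      unfold Rdiv. lra.
    + unfold B. field. lra.
Qed.

(** On the column [s = L] the height stays below the pole, because
    [(1 + d / PI) (PI - d) = PI - d^2 / PI]; so [d / PI] can serve as the margin of the homotopy. *)
Let fermi_homotopy (th s t : R) :
  - (d / PI) < th < 1 + d / PI -> (s = L -> t = PI - d) -> fermi L (s, th * t) <> 0.
Proof.
  intros Hth Ht. apply fermi_neq_0.
  destruct (Req_dec s L) as [E | E]; [right | now left].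
  rewrite (Ht E). destruct d_bound as [Hd Hd'].
  assert (Hp : d / PI * PI = d) by (field; lra).
  assert (0 < d / PI) by (apply Rdiv_lt_0_compat; lra).
  apply Rabs_def1; nra.
Qed.

Lemma continuous_integrand (s : R) :
  continuous (fun s => exp (al * s) / (1 + exp (s - L)) * cos (lam * s ^ 2)) s.
Proof.
  apply (ex_derive_continuous (V := R_NormedModule)). auto_derive.
  pose proof (exp_pos (s - L)). unfold Rminus in *. lra.
Qed.

(** Each arm is deformed separately, as the homotopy needs an affine height. Both arms reach
    [PI - d] at [L], so the vertical integral there occurs with opposite signs and cancels; 100 is
    75 + 25. *)
Lemma oscillatory_integral_le (b : R) :
  L + 1 <= b ->
  Rabs (RInt (fun s => exp (al * s) / (1 + exp (s - L)) * cos (lam * s ^ 2)) sg b) <=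
  exp (al * sg) * (al * sg ^ 2 + sg ^ 2 * exp (sg - L) + sg) / INR N ^ 2
  + 100 * k * exp (al * L - INR N * (q - 1))
  + exp L / lam / b.
Proof.
  intros Hb.
  destruct d_bound as [Hd Hd'].
  assert (Hdp : 0 < d / PI) by (apply Rdiv_lt_0_compat; lra).
  assert (Hex : forall u v, ex_RInt (fun s => Re (osc al lam L (s, 0))) u v).
  { intros u v. apply (ex_RInt_continuous (V := R_CompleteNormedModule)); intros s _.
    apply (continuous_ext (fun s => exp (al * s) / (1 + exp (s - L)) * cos (lam * s ^ 2))).
    - intros t. symmetry; apply Re_osc_real.
    - apply continuous_integrand. }
  rewrite (RInt_ext (V := R_CompleteNormedModule) _ (fun s => Re (osc al lam L (s, 0))))
    by (intros; symmetry; apply Re_osc_real).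
  rewrite <- (RInt_Chasles (V := R_CompleteNormedModule) _ sg L b (Hex _ _) (Hex _ _)).
  change plus with Rplus.
  assert (Hl : forall th s, - (d / PI) < th < 1 + d / PI ->
                 fermi L (s, th * (PI - d + k * L + - k * s)) <> 0)
    by (intros th s Hth; apply (fermi_homotopy _ _ _ Hth); intros ->; ring).
  assert (Hr : forall th s, - (d / PI) < th < 1 + d / PI ->
                 fermi L (s, th * (PI - d - k * L + k * s)) <> 0)
    by (intros th s Hth; apply (fermi_homotopy _ _ _ Hth); intros ->; ring).
  rewrite (RInt_deform _ _ _ _ _ _ (holo_osc al lam L) Hdp Hl sg L).
  rewrite (RInt_deform _ _ _ _ _ _ (holo_osc al lam L) Hdp Hr L b).
  replace (PI - d + k * L + - k * L) with (PI - d) by ring.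
  replace (PI - d - k * L + k * L) with (PI - d) by ring.
  pose proof line_left_le as H1. pose proof (line_right_le b ltac:(lra)) as H2.
  pose proof (vertical_start_le (PI - d + k * L + - k * sg) ltac:(nra)) as H3.
  pose proof (vertical_end_le b (PI - d - k * L + k * b) Hb ltac:(nra)) as H4.
  revert H1 H2 H3 H4.
  generalize (RInt (fun th => Re (osc al lam L (L, th * (PI - d)) * (0, PI - d))) 0 1).
  intros V H1 H2 H3 H4.
  apply Rabs_le_between in H1, H2, H3, H4. apply Rabs_le_between.
  lra.
Qed.

End Contour.


(** * Improper integrals *)

Lemma RInt_exp_decay_converges (f : R -> R) (a c M : R) :
  0 < c -> (forall s, a <= s -> continuous f s) ->
  (forall s, a <= s -> Rabs (f s) <= M * exp (- c * s)) ->
  exists l, filterlim (fun b => RInt f a b) (Rbar_locally p_infty) (locally l).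
Proof.
  intros Hc Hf HM.
  assert (HM0 : 0 <= M).
  { pose proof (HM a (Rle_refl a)). pose proof (Rabs_pos (f a)).
    pose proof (exp_pos (- c * a)). nra. }
  assert (Hex : forall u v, a <= u -> a <= v -> ex_RInt f u v).
  { intros u v Hu Hv. apply (ex_RInt_continuous (V := R_CompleteNormedModule)); intros s Hs.
    apply Hf. apply Rle_trans with (2 := proj1 Hs). now apply Rmin_glb. }
  assert (Htail : forall u v, a <= u <= v -> Rabs (RInt f u v) <= M * exp (- c * u) / c).
  { intros u v Huv.
    pose proof (exp_pos (- c * u)).
    apply RInt_abs_le_exp_left; [lra | exact Hc | nra | |].
    - intros s Hs; apply Hf; lra.
    - intros s Hs. rewrite Rmult_assoc, <- exp_plus.
      replace (- c * u + - c * (s - u)) with (- c * s) by ring. apply HM; lra. }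
  apply (filterlim_locally_cauchy (U := R_CompleteSpace)
           (F := Rbar_locally p_infty) (fun b => RInt f a b)).
  intros eps.
  set (u0 := Rmax a (M / (c * c * eps))).
  pose proof (cond_pos eps) as Heps.
  assert (Hcce : 0 < c * c * eps) by (repeat apply Rmult_lt_0_compat; assumption).
  assert (Hu0 : a <= u0) by apply Rmax_l.
  assert (Hsmall : forall u, u0 < u -> M * exp (- c * u) / c < eps).
  { intros u Hu.
    assert (H1 : M / (c * c * eps) < u) by (apply Rle_lt_trans with (2 := Hu), Rmax_r).
    assert (H1' : M < u * (c * c * eps)).
    { apply Rmult_lt_compat_r with (r := c * c * eps) in H1; [| exact Hcce].
      unfold Rdiv in H1. rewrite Rmult_assoc, Rinv_l in H1 by lra. lra. }
    pose proof (exp_ge_1_plus (c * u)) as H2. pose proof (exp_pos (c * u)) as H3.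
    replace (- c * u) with (- (c * u)) by ring. rewrite exp_Ropp.
    apply Rmult_lt_reg_r with (c * exp (c * u)); [nra |].
    replace (M * / exp (c * u) / c * (c * exp (c * u))) with M by (field; lra).
    assert (eps * c * (1 + c * u) <= eps * (c * exp (c * u))).
    { rewrite Rmult_assoc. apply Rmult_le_compat_l; [lra |]. nra. }
    nra. }
  assert (Hle : forall u v, u0 < u -> u <= v -> Rabs (RInt f a v - RInt f a u) < eps).
  { intros u v Hu Huv.
    assert (E : RInt f a u + RInt f u v = RInt f a v)
      by (apply (RInt_Chasles (V := R_CompleteNormedModule)); apply Hex; lra).
    replace (RInt f a v - RInt f a u) with (RInt f u v) by lra.
    apply Rle_lt_trans with (2 := Hsmall u Hu). apply Htail; lra. }
  exists (fun b => u0 < b). split; [now exists u0 |].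
  intros u v Hu Hv. change (Rabs (RInt f a v - RInt f a u) < eps).
  destruct (Rle_dec u v); [now apply Hle |].
  rewrite Rabs_minus_sym. apply Hle; lra.
Qed.

Lemma is_RInt_gen_half_line (f : R -> R) (a l : R) :
  (forall b, a <= b -> ex_RInt f a b) ->
  filterlim (fun b => RInt f a b) (Rbar_locally p_infty) (locally l) ->
  is_RInt_gen f (at_point a) (Rbar_locally p_infty) l.
Proof.
  intros Hex Hl.
  apply (filterlimi_lim_ext_loc (fun ab => RInt f (fst ab) (snd ab))).
  - exists (fun x => x = a) (fun b => a <= b); [reflexivity | |].
    + exists a. intros; lra.
    + intros x y -> Hy. apply (RInt_correct (V := R_CompleteNormedModule)), Hex, Hy.
  - intros P HP. exists (fun x => x = a) (fun b => P (RInt f a b)); [reflexivity | |].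
    + apply (Hl P HP).
    + now intros x y ->.
Qed.

Lemma is_RInt_gen_reflect (f : R -> R) (a l : R) :
  is_RInt_gen (fun u => f (- u)) (at_point a) (Rbar_locally p_infty) l ->
  is_RInt_gen f (Rbar_locally m_infty) (at_point (- a)) l.
Proof.
  intros H P HP. destruct (H P HP) as [Q S HQ [M HM] HQS].
  exists (fun x => S (- x)) (fun x => x = - a); [| reflexivity |].
  - exists (- M). intros x Hx. apply HM. lra.
  - intros x y Hx ->.
    destruct (HQS a (- x) HQ Hx) as [v [Hv HPv]]. exists v; split; [| exact HPv].
    simpl in *.
    apply (is_RInt_ext (V := R_NormedModule) (fun u => opp (opp (f (- - u))))).
    + intros u _. rewrite opp_opp, Ropp_involutive. reflexivity.
    + rewrite <- (opp_opp v).
      apply (is_RInt_opp (V := R_NormedModule) (fun u => opp (f (- - u)))).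
      apply (is_RInt_swap (V := R_NormedModule)).
      apply (is_RInt_comp_opp (V := R_NormedModule) (fun u => f (- u))).
      now rewrite Ropp_involutive.
Qed.

Lemma is_RInt_gen_line (f : R -> R) (h lm l0 lp : R) :
  (forall b, h <= b -> ex_RInt f h b) ->
  (forall b, h <= b -> ex_RInt (fun u => f (- u)) h b) ->
  filterlim (fun b => RInt f h b) (Rbar_locally p_infty) (locally lp) ->
  filterlim (fun b => RInt (fun u => f (- u)) h b) (Rbar_locally p_infty) (locally lm) ->
  is_RInt f (- h) h l0 ->
  is_RInt_gen f (Rbar_locally m_infty) (Rbar_locally p_infty) (lm + l0 + lp).
Proof.
  intros H1 H2 H3 H4 H5.
  apply (is_RInt_gen_Chasles (V := R_NormedModule) f h).
  - apply (is_RInt_gen_Chasles (V := R_NormedModule) f (- h)).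
    + now apply is_RInt_gen_reflect, is_RInt_gen_half_line.
    + now apply is_RInt_gen_at_point.
  - now apply is_RInt_gen_half_line.
Qed.

(** The error [E / b] stands for the far vertical segment, which disappears in the limit. *)
Lemma Rabs_lim_le (f : R -> R) (l A E : R) :
  filterlim f (Rbar_locally p_infty) (locally l) ->
  Rbar_locally p_infty (fun b => Rabs (f b) <= A + E / b) ->
  Rabs l <= A.
Proof.
  intros Hl HA. apply le_epsilon; intros eps Heps.
  assert (He2 : 0 < eps / 2) by lra.
  assert (H1 : Rbar_locally p_infty (fun b => Rabs (f b - l) < eps / 2)).
  { apply (Hl (fun v => Rabs (v - l) < eps / 2)). now exists (mkposreal _ He2). }
  assert (H2 : Rbar_locally p_infty (fun b => E / b <= eps / 2)).
  { exists (Rmax 1 (2 * Rabs E / eps)). intros b Hb.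
    pose proof (Rmax_l 1 (2 * Rabs E / eps)). pose proof (Rmax_r 1 (2 * Rabs E / eps)).
    assert (H3 : 2 * Rabs E / eps < b) by lra.
    apply Rmult_lt_compat_r with (r := eps) in H3; [| lra].
    unfold Rdiv in H3. rewrite Rmult_assoc, Rinv_l, Rmult_1_r in H3 by lra.
    apply Rmult_le_reg_r with b; [lra |].
    unfold Rdiv at 1. rewrite Rmult_assoc, Rinv_l by lra.
    pose proof (Rle_abs E). lra. }
  destruct (filter_ex (F := Rbar_locally p_infty) _
              (filter_and _ _ HA (filter_and _ _ H1 H2))) as [b [Hb1 [Hb2 Hb3]]].
  rewrite Rabs_minus_sym in Hb2.
  pose proof (Rabs_triang (f b) (l - f b)) as Ht.
  replace (f b + (l - f b)) with l in Ht by ring. lra.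
Qed.

(** * The Fourier transform of [fhat] *)

Section Fourier.

Variables (al sg T x : R).
Hypothesis Hal : 0 < al < 1.
Hypothesis Hsg : 0 < sg.
Hypothesis Hx : 0 < x.

Let h := sg ^ 2 * al ^ 2.
Let L := (T + al * ln x) / al.

Let h_pos : 0 < h.
Proof. unfold h. apply Rmult_lt_0_compat; apply pow_lt; lra. Qed.

(** Because [L = T / al + ln x], the exponential in the denominator is [x exp (s - L)]; the factor
    [x] cancels and survives only inside [L]. *)
Lemma f_at_square (s : R) :
  0 < s ->
  2 * al ^ 2 * s * f_ al T ((al * s) ^ 2) x =
  sin (al * PI) / PI * exp (- T) * (exp (al * s) / (1 + exp (s - L))).
Proof.
  intros Hs. unfold f_.
  assert (Has : 0 < al * s) by nra.
  replace ((al * s) ^ 2) with (Rsqr (al * s)) by (unfold Rsqr; ring).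
  rewrite sqrt_Rsqr by lra.
  assert (E1 : exp ((al * s - T) / al) = x * exp (s - L)).
  { rewrite <- (exp_ln x Hx) at 1. rewrite <- exp_plus. f_equal. unfold L. field. lra. }
  rewrite E1. unfold Rminus at 1. rewrite exp_plus.
  pose proof (exp_pos (s - L)). pose proof PI_RGT_0.
  field. repeat split; try lra. nra.
Qed.

Lemma continuous_f (u : R) : 0 < u -> continuous (fun u => f_ al T u x) u.
Proof.
  intros Hu. apply (ex_derive_continuous (V := R_NormedModule)). unfold f_.
  pose proof (sqrt_lt_R0 u Hu). pose proof (exp_pos ((sqrt u - T) / al)).
  auto_derive. repeat split; try lra. unfold Rminus, Rdiv in *. lra.
Qed.

Section Test.

(** [g] will be the cosine or the sine of [xi u], so both components of the transform are treated at
    once. *)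
Variable g : R -> R.
Hypothesis Hg : forall u, continuous g u.
Hypothesis Hg1 : forall u, Rabs (g u) <= 1.

Let intg (s : R) : R := exp (al * s) / (1 + exp (s - L)) * g ((al * s) ^ 2).

Let continuous_intg (s : R) : continuous intg s.
Proof.
  apply (continuous_mult (K := R_AbsRing) (fun s => exp (al * s) / (1 + exp (s - L)))).
  - apply (ex_derive_continuous (V := R_NormedModule)). auto_derive.
    pose proof (exp_pos (s - L)). unfold Rminus in *. lra.
  - apply (continuous_comp (fun s => (al * s) ^ 2) g); [| apply Hg].
    apply (ex_derive_continuous (V := R_NormedModule)). now auto_derive.
Qed.

Lemma RInt_f_square (b : R) :
  sg <= b ->
  RInt (fun u => f_ al T u x * g u) h ((al * b) ^ 2) =
  sin (al * PI) / PI * exp (- T) * RInt intg sg b.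
Proof.
  intros Hb.
  replace h with ((al * sg) ^ 2) by (unfold h; ring).
  rewrite <- (RInt_comp (V := R_CompleteNormedModule) (fun u => f_ al T u x * g u)
           (fun s => (al * s) ^ 2) (fun s => 2 * al ^ 2 * s)).
  - rewrite <- (RInt_scal (V := R_CompleteNormedModule)).
    + apply (RInt_ext (V := R_CompleteNormedModule)). intros s Hs.
      rewrite Rmin_left, Rmax_right in Hs by lra.
      change (2 * al ^ 2 * s * (f_ al T ((al * s) ^ 2) x * g ((al * s) ^ 2)) =
        sin (al * PI) / PI * exp (- T) *
          (exp (al * s) / (1 + exp (s - L)) * g ((al * s) ^ 2))).
      rewrite <- (Rmult_assoc _ _ (g _)), (f_at_square s) by lra. ring.
    + apply (ex_RInt_continuous (V := R_CompleteNormedModule)). intros; apply continuous_intg.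
  - intros s Hs. rewrite Rmin_left, Rmax_right in Hs by lra.
    apply (continuous_mult (K := R_AbsRing)); [| apply Hg].
    apply continuous_f, pow_lt. nra.
  - intros s Hs. split; [auto_derive; trivial; simpl; ring |].
    apply (ex_derive_continuous (V := R_NormedModule)). now auto_derive.
Qed.

Lemma half_line_transform_converges :
  exists J, filterlim (fun b => RInt intg sg b) (Rbar_locally p_infty) (locally J) /\
    filterlim (fun b => RInt (fun u => f_ al T u x * g u) h b) (Rbar_locally p_infty)
      (locally (sin (al * PI) / PI * exp (- T) * J)).
Proof.
  (* Dropping the 1 in the denominator leaves [exp (al s - (s - L))], which decays at rate
     [1 - al]. *)
  destruct (RInt_exp_decay_converges intg sg (1 - al) (exp L)) as [J HJ].
  - lra.
  - intros; apply continuous_intg.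
  - intros s _. unfold intg. rewrite Rabs_mult.
    pose proof (exp_pos (s - L)) as H1. pose proof (exp_pos (al * s)) as H2.
    assert (H3 : 0 < exp (al * s) / (1 + exp (s - L))) by (apply Rdiv_lt_0_compat; lra).
    rewrite (Rabs_right (exp _ / _)) by lra.
    apply Rle_trans with (exp (al * s) / (1 + exp (s - L)) * 1).
    { apply Rmult_le_compat_l; [lra | apply Hg1]. }
    rewrite Rmult_1_r.
    apply Rle_trans with (exp (al * s) / exp (s - L)).
    { apply Rmult_le_compat_l; [lra |]. apply Rinv_le_contravar; lra. }
    right. unfold Rdiv. rewrite <- exp_Ropp, <- !exp_plus. f_equal. ring.
  - exists J; split; [exact HJ |].
    assert (Hs : filterlim (fun B => sqrt B / al) (Rbar_locally p_infty) (Rbar_locally p_infty)).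
    { intros P [M HM]. exists (Rmax 0 (al * M) ^ 2). intros B HB. apply HM.
      assert (Hm : 0 <= Rmax 0 (al * M)) by apply Rmax_l.
      assert (Hq : Rmax 0 (al * M) < sqrt B).
      { rewrite <- (sqrt_pow2 _ Hm). apply sqrt_lt_1; [apply pow2_ge_0 | | exact HB].
        pose proof (pow2_ge_0 (Rmax 0 (al * M))). lra. }
      pose proof (Rmax_r 0 (al * M)).
      apply Rmult_lt_reg_l with al; [lra |].
      replace (al * (sqrt B / al)) with (sqrt B) by (field; lra). lra. }
    apply (filterlim_ext_loc
      (fun B => sin (al * PI) / PI * exp (- T) * RInt intg sg (sqrt B / al))).
    + exists h. intros B HB.
      assert (Hsq : sqrt h = al * sg).
      { replace h with (Rsqr (al * sg)) by (unfold h, Rsqr; ring). apply sqrt_Rsqr. nra. }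
      assert (Hle : al * sg <= sqrt B) by (rewrite <- Hsq; apply sqrt_le_1_alt; lra).
      rewrite <- RInt_f_square.
      * f_equal. replace (al * (sqrt B / al)) with (sqrt B) by (field; lra).
        apply pow2_sqrt. lra.
      * apply Rmult_le_reg_l with al; [lra |].
        replace (al * (sqrt B / al)) with (sqrt B) by (field; lra). exact Hle.
    + apply (filterlim_comp _ _ _ (fun B => RInt intg sg (sqrt B / al))
        (fun v => sin (al * PI) / PI * exp (- T) * v) _ (locally J)).
      * apply (filterlim_comp _ _ _ (fun B => sqrt B / al) (fun b => RInt intg sg b) _ _ _ Hs HJ).
      * apply (filterlim_scal_r (V := R_NormedModule)).
Qed.

Lemma ex_RInt_f_test (b : R) : h <= b -> ex_RInt (fun u => f_ al T u x * g u) h b.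
Proof.
  intros Hb. apply (ex_RInt_continuous (V := R_CompleteNormedModule)). intros u Hu.
  rewrite Rmin_left in Hu by lra.
  apply (continuous_mult (K := R_AbsRing)); [| apply Hg].
  apply continuous_f. lra.
Qed.

End Test.

Let w (u : R) : R := fhat al T h u x.

Lemma fhat_right (u : R) : h < u -> w u = f_ al T u x.
Proof. intros H. unfold w, fhat. destruct (Rle_dec h u); [reflexivity | lra]. Qed.

Lemma fhat_left (u : R) : h < u -> w (- u) = f_ al T u x.
Proof.
  intros H. unfold w, fhat. destruct (Rle_dec h (- u)); [lra |].
  destruct (Rle_dec (- h) (- u)); [lra |]. now rewrite Ropp_involutive.
Qed.

Lemma fhat_middle (u : R) : - h < u < h -> w u = f_ al T h x.
Proof.
  intros H. unfold w, fhat. destruct (Rle_dec h u); [lra |].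
  destruct (Rle_dec (- h) u); [reflexivity | lra].
Qed.

(** [e] is the parity of [g]: with 1 the two half-lines add up, with -1 they cancel, which makes the
    transform real. [c] is the contribution of the constant middle piece. *)
Lemma is_RInt_gen_fhat (g : R -> R) (e c l : R) :
  (forall u, continuous g u) -> (forall u, g (- u) = e * g u) ->
  is_RInt g (- h) h c ->
  filterlim (fun b => RInt (fun u => f_ al T u x * g u) h b) (Rbar_locally p_infty) (locally l) ->
  is_RInt_gen (fun u => w u * g u) (Rbar_locally m_infty) (Rbar_locally p_infty)
    (e * l + f_ al T h x * c + l).
Proof.
  intros Hg He Hc Hl.
  assert (Hr : forall b u, h <= b -> Rmin h b < u < Rmax h b ->
                 f_ al T u x * g u = w u * g u).
  { intros b u Hb Hu. rewrite Rmin_left in Hu by lra. rewrite fhat_right; [reflexivity | lra]. }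
  assert (Hm : forall b u, h <= b -> Rmin h b < u < Rmax h b ->
                 e * (f_ al T u x * g u) = w (- u) * g (- u)).
  { intros b u Hb Hu. rewrite Rmin_left in Hu by lra. rewrite fhat_left, He by lra. ring. }
  apply is_RInt_gen_line with h.
  - intros b Hb. apply (ex_RInt_ext (V := R_NormedModule) (fun u => f_ al T u x * g u)).
    + intros u Hu. now apply (Hr b).
    + now apply ex_RInt_f_test.
  - intros b Hb. apply (ex_RInt_ext (V := R_NormedModule) (fun u => e * (f_ al T u x * g u))).
    + intros u Hu. now apply (Hm b).
    + apply (ex_RInt_scal (V := R_NormedModule)). now apply ex_RInt_f_test.
  - apply (filterlim_ext_loc (fun b => RInt (fun u => f_ al T u x * g u) h b)); [| exact Hl].
    exists h. intros b Hb. apply (RInt_ext (V := R_CompleteNormedModule)).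
    intros u Hu. apply (Hr b u); [lra | exact Hu].
  - apply (filterlim_ext_loc (fun b => e * RInt (fun u => f_ al T u x * g u) h b)).
    + exists h. intros b Hb.
      rewrite <- (RInt_scal (V := R_CompleteNormedModule)) by (apply ex_RInt_f_test; [exact Hg | lra]).
      apply (RInt_ext (V := R_CompleteNormedModule)).
      intros u Hu. apply (Hm b u); [lra | exact Hu].
    + apply (filterlim_comp _ _ _ (fun b => RInt (fun u => f_ al T u x * g u) h b)
        (fun v => e * v) _ (locally l)); [exact Hl |].
      apply (filterlim_scal_r (V := R_NormedModule)).
  - apply (is_RInt_ext (V := R_NormedModule) (fun u => f_ al T h x * g u)).
    + intros u Hu. rewrite Rmin_left, Rmax_right in Hu by lra.
      rewrite fhat_middle; [reflexivity | exact Hu].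
    + now apply (is_RInt_scal (V := R_NormedModule)).
Qed.

Lemma is_RInt_cos_period (xi : R) :
  xi <> 0 -> sin (xi * h) = 0 -> is_RInt (fun u => cos (xi * u)) (- h) h 0.
Proof.
  intros Hxi Hs. evar_last.
  - apply (is_RInt_derive (V := R_CompleteNormedModule) (fun u => sin (xi * u) / xi)).
    + intros u _. auto_derive; trivial. field; exact Hxi.
    + intros u _. apply (ex_derive_continuous (V := R_NormedModule)). now auto_derive.
  - unfold minus, plus, opp; simpl.
    replace (xi * - h) with (- (xi * h)) by ring. rewrite sin_neg, Hs. field; exact Hxi.
Qed.

Lemma is_RInt_sin_odd (xi : R) :
  xi <> 0 -> is_RInt (fun u => sin (xi * u)) (- h) h 0.
Proof.
  intros Hxi. evar_last.
  - apply (is_RInt_derive (V := R_CompleteNormedModule) (fun u => - cos (xi * u) / xi)).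
    + intros u _. auto_derive; trivial. field; exact Hxi.
    + intros u _. apply (ex_derive_continuous (V := R_NormedModule)). now auto_derive.
  - unfold minus, plus, opp; simpl.
    replace (xi * - h) with (- (xi * h)) by ring. rewrite cos_neg. field; exact Hxi.
Qed.

Hypothesis HL : 2 * sg + 2 <= L.
Hypothesis HL2 : sg ^ 2 / 2 <= L.

Let q := 4 * PI ^ 2 * L / sg ^ 2.
Let k := 2 * PI * (1 + / sg).

Lemma fourier_fhat (n : Z) :
  n <> 0%Z ->
  fourier_exists w (2 * IZR n * PI / h) /\
  fourier_im w (2 * IZR n * PI / h) = 0 /\
  Rabs (fourier_re w (2 * IZR n * PI / h)) <=
    2 * (al * exp (- T) *
      (exp (al * sg) * (al * sg ^ 2 + sg ^ 2 * exp (sg - L) + sg) / INR (Z.abs_nat n) ^ 2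
       + 100 * k * exp (al * L - INR (Z.abs_nat n) * (q - 1)))).
Proof.
  intros Hn.
  set (xi := 2 * IZR n * PI / h). set (N := Z.abs_nat n).
  pose proof PI_RGT_0 as Hpi.
  assert (Hn' : IZR n <> 0) by now apply not_0_IZR.
  assert (Hxi : xi <> 0).
  { unfold xi, Rdiv. apply Rmult_integral_contrapositive_currified.
    - apply Rmult_integral_contrapositive_currified; lra.
    - apply Rinv_neq_0_compat; lra. }
  assert (HN : (1 <= N)%nat) by (unfold N; lia).
  assert (Hsin : sin (xi * h) = 0).
  { apply sin_eq_0_1. exists (2 * n)%Z. unfold xi. rewrite mult_IZR. field. lra. }
  assert (Ccos : forall u, continuous (fun u => cos (xi * u)) u).
  { intros u. apply (ex_derive_continuous (V := R_NormedModule)). now auto_derive. }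
  assert (Csin : forall u, continuous (fun u => sin (xi * u)) u).
  { intros u. apply (ex_derive_continuous (V := R_NormedModule)). now auto_derive. }
  destruct (half_line_transform_converges _ Ccos) as [J [HJ1 HJ2]].
  { intros u. apply Rabs_le, COS_bound. }
  destruct (half_line_transform_converges _ Csin) as [J' [HJ1' HJ2']].
  { intros u. apply Rabs_le, SIN_bound. }
  set (K := sin (al * PI) / PI * exp (- T)) in *.
  assert (Hc : is_RInt_gen (fun u => w u * cos (xi * u)) (Rbar_locally m_infty)
                 (Rbar_locally p_infty) (1 * (K * J) + f_ al T h x * 0 + K * J)).
  { apply is_RInt_gen_fhat with (g := fun u => cos (xi * u)); trivial.
    - intros u. replace (xi * - u) with (- (xi * u)) by ring. rewrite cos_neg. ring.
    - now apply is_RInt_cos_period. }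
  assert (Hs : is_RInt_gen (fun u => w u * sin (xi * u)) (Rbar_locally m_infty)
                 (Rbar_locally p_infty) (-1 * (K * J') + f_ al T h x * 0 + K * J')).
  { apply is_RInt_gen_fhat with (g := fun u => sin (xi * u)); trivial.
    - intros u. replace (xi * - u) with (- (xi * u)) by ring. rewrite sin_neg. ring.
    - now apply is_RInt_sin_odd. }
  split; [split; eexists; eassumption |].
  unfold fourier_im, fourier_re.
  rewrite (is_RInt_gen_unique (V := R_CompleteNormedModule) _ _ Hc).
  rewrite (is_RInt_gen_unique (V := R_CompleteNormedModule) _ _ Hs).
  split; [ring |].
  replace (1 * (K * J) + f_ al T h x * 0 + K * J) with (2 * (K * J)) by ring.
  rewrite Rabs_mult, (Rabs_right 2) by lra.
  apply Rmult_le_compat_l; [lra |].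
  rewrite Rabs_mult.
  apply Rmult_le_compat; try apply Rabs_pos.
  (* From [|sin (al PI)| <= al PI], not from 1: the factor [al] is needed by the uniform estimates
     at the end. *)
  - unfold K. rewrite Rabs_mult, (Rabs_right (exp _)) by (apply Rle_ge, Rlt_le, exp_pos).
    apply Rmult_le_compat_r; [apply Rlt_le, exp_pos |].
    unfold Rdiv. rewrite Rabs_mult, (Rabs_right (/ PI))
      by (apply Rle_ge, Rlt_le, Rinv_0_lt_compat; lra).
    apply Rmult_le_reg_r with PI; [lra |]. rewrite Rmult_assoc, Rinv_l, Rmult_1_r by lra.
    apply Rle_trans with (1 := Rabs_sin_le _). rewrite Rabs_right; nra.
  - apply (Rabs_lim_le _ _ _ (exp L / (2 * PI * INR N / sg ^ 2)) HJ1).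
    exists (L + 1). intros b Hb.
    rewrite (RInt_ext (V := R_CompleteNormedModule) _
      (fun s => exp (al * s) / (1 + exp (s - L)) * cos (2 * PI * INR N / sg ^ 2 * s ^ 2))).
    + apply oscillatory_integral_le; trivial. lra.
    + intros s _. f_equal.
      assert (E : xi * (al * s) ^ 2 = 2 * PI * IZR n / sg ^ 2 * s ^ 2).
      { unfold xi, h. field. lra. }
      rewrite E. unfold N. rewrite INR_IZR_INZ, Nat2Z.inj_abs_nat.
      destruct (Z.abs_eq_or_opp n) as [-> | ->]; [reflexivity |].
      rewrite opp_IZR, <- cos_neg. f_equal. field. lra.
Qed.

End Fourier.


(** * Consequences of the hypotheses on [x] *)

(** With [t = 1 - 2 al] and [r = sqrt (2 - t^2)], [u_star] becomes [2 (1 + t r) / (1 + t)^2], and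
    [r^2 + t^2 = 2] makes the comparisons algebraic. *)
Lemma u_star_bounds (al : R) : 0 < al < 1 -> 1 < u_star al <= 4.
Proof.
  intros Hal. unfold u_star.
  set (t := 1 - 2 * al).
  assert (E1 : 4 * al - 4 * al ^ 2 + 1 = 2 - t ^ 2) by (unfold t; ring).
  assert (E2 : 2 * (1 - al) ^ 2 = (1 + t) ^ 2 / 2) by (unfold t; field).
  rewrite E1, E2.
  assert (Ht : -1 < t < 1) by (unfold t; lra).
  assert (Ht2 : t ^ 2 < 1) by nra.
  set (r := sqrt (2 - t ^ 2)).
  assert (Hr2 : r ^ 2 = 2 - t ^ 2) by (apply pow2_sqrt; lra).
  assert (Hr1 : 1 < r) by (rewrite <- sqrt_1; apply sqrt_lt_1; lra).
  assert (Hden : 0 < (1 + t) ^ 2 / 2) by nra.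
  split.
  - apply Rmult_lt_reg_r with ((1 + t) ^ 2 / 2); [exact Hden |].
    unfold Rdiv at 2. rewrite Rmult_assoc, Rinv_l by lra.
    (* twice the difference of the two sides is [(r - 1) (r + 1 + 2 t)] *)
    assert (0 < (r - 1) * (r + 1 + 2 * t)) by nra. nra.
  - apply Rmult_le_reg_r with ((1 + t) ^ 2 / 2); [exact Hden |].
    unfold Rdiv at 1. rewrite Rmult_assoc, Rinv_l by lra.
    destruct (Rle_dec 0 t) as [H | H].
    + pose proof (pow2_ge_0 (t - r)). nra.
    + set (e := 1 + t) in *.
      assert (He : 0 < e < 1) by (unfold e; lra).
      (* Both sides of the goal vanish to second order at [e = 0], so [r = sqrt (1 + 2 e - e^2)] is
         needed to that order; the left side is its Taylor polynomial. *)
      assert (Hre : 1 + e - e ^ 2 <= r).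
      { apply Rsqr_incr_0_var; [| lra].
        unfold Rsqr. replace (r * r) with (r ^ 2) by ring. rewrite Hr2.
        replace (2 - t ^ 2) with (1 + 2 * e - e ^ 2) by (unfold e; ring).
        assert (0 <= e ^ 3 * (2 - e)) by (apply Rmult_le_pos; [apply pow_le |]; lra). nra. }
      assert ((1 - e) * (1 + e - e ^ 2) <= (1 - e) * r) by (apply Rmult_le_compat_l; lra).
      assert (0 < e ^ 3) by (apply pow_lt; lra).
      replace t with (e - 1) by (unfold e; ring). nra.
Qed.

(** The bound [x >= x_star] says [T + al ln x >= gamma_]; positivity is what allows square roots to
    be taken in the condition involving [M0]. *)
Lemma gamma_pos (al : R) : 0 < al < 1 -> 0 < gamma_ al.
Proof.
  intros Hal. destruct (u_star_bounds al Hal) as [H1 H2]. unfold gamma_, kappa.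
  set (v := sqrt (u_star al)).
  assert (Hv1 : 1 < v) by (rewrite <- sqrt_1; apply sqrt_lt_1; lra).
  assert (Hv2 : v <= 2).
  { replace 2 with (sqrt (2 * 2)) by (apply sqrt_square; lra). apply sqrt_le_1_alt; lra. }
  assert (Hk : 0 < / (al / (1 - al))) by (apply Rinv_0_lt_compat, Rdiv_lt_0_compat; lra).
  assert (Hr : 1 <= (/ (al / (1 - al)) * v + 1) / (v - 1)).
  { apply Rmult_le_reg_r with (v - 1); [lra |].
    unfold Rdiv at 1. rewrite Rmult_assoc, Rinv_l by lra. nra. }
  assert (0 <= ln ((/ (al / (1 - al)) * v + 1) / (v - 1))).
  { rewrite <- ln_1. destruct Hr as [Hr | Hr]; [left; apply ln_increasing; lra | right; now rewrite <- Hr]. }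
  nra.
Qed.

Lemma Rceil_ge (y : R) : y <= Rceil y.
Proof.
  unfold Rceil. rewrite minus_IZR. destruct (archimed (- y)). lra.
Qed.

(** The first bound is the first entry of the maximum; the second is the last entry, through
    [(1 + r)^4 >= (1 + r^2)^2] with [r = sqrt (PI / sg)]. *)
Lemma M0_ge (sg : R) : 0 < sg -> sg ^ 2 / 2 <= M0 sg /\ 4 * (1 + PI / sg) ^ 2 <= M0 sg.
Proof.
  intros Hsg. unfold M0.
  set (A := sg ^ 2 / 4). set (B := 1 + Rceil (9 * PI ^ 2 / sg ^ 2)).
  set (D := Rceil ((1 + sqrt (PI / sg)) ^ 4)).
  pose proof (Rmax_l A (Rmax B (2 * D))). pose proof (Rmax_r A (Rmax B (2 * D))).
  pose proof (Rmax_r B (2 * D)).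
  split; [unfold A in *; lra |].
  pose proof (Rceil_ge ((1 + sqrt (PI / sg)) ^ 4)) as HD. fold D in HD.
  assert (Hp : 0 < PI / sg) by (apply Rdiv_lt_0_compat; [apply PI_RGT_0 | exact Hsg]).
  set (r := sqrt (PI / sg)) in *.
  assert (Hr : 0 <= r) by apply sqrt_pos.
  assert (E : PI / sg = r ^ 2) by (symmetry; apply pow2_sqrt; lra).
  rewrite E.
  assert ((1 + r ^ 2) ^ 2 <= (1 + r) ^ 4).
  { replace ((1 + r) ^ 4) with (((1 + r) ^ 2) ^ 2) by ring.
    apply pow_incr. split; nra. }
  lra.
Qed.

(** Divided by [al^2], the condition reads [L^2 > PI^2 + M0 sg^2]. The two bounds on [M0] make the
    right side at least [(2 sg + 2 PI)^2] and at least [(sg^2 / 2)^2]. *)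
Lemma scaled_height_bounds (al sg T x : R) :
  0 < al < 1 -> 0 < sg -> x_star al T <= x ->
  (T + al * ln x) ^ 2 - al ^ 2 * PI ^ 2 > M0 sg * (sg ^ 2 * al ^ 2) ->
  2 * sg + 2 <= (T + al * ln x) / al /\ sg ^ 2 / 2 <= (T + al * ln x) / al.
Proof.
  intros Hal Hsg Hx HM.
  assert (Hx0 : 0 < x) by (apply Rlt_le_trans with (2 := Hx), exp_pos).
  assert (Hln : / al * (gamma_ al - T) <= ln x).
  { unfold x_star in Hx. rewrite <- (ln_exp (/ al * _)).
    destruct Hx as [Hx | <-]; [left; apply ln_increasing; [apply exp_pos | exact Hx] | lra]. }
  assert (Hpos : 0 < T + al * ln x).
  { pose proof (gamma_pos al Hal).
    apply Rmult_le_compat_l with (r := al) in Hln; [| lra].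
    rewrite <- Rmult_assoc, Rinv_r, Rmult_1_l in Hln by lra. lra. }
  set (L := (T + al * ln x) / al).
  assert (HL : 0 < L) by (apply Rdiv_lt_0_compat; lra).
  replace (T + al * ln x) with (al * L) in HM by (unfold L; field; lra).
  assert (HL2 : PI ^ 2 + M0 sg * sg ^ 2 < L ^ 2).
  { apply Rmult_lt_reg_l with (al ^ 2); [apply pow_lt; lra |]. nra. }
  destruct (M0_ge sg Hsg) as [H1 H2].
  assert (Hs2 : 0 < sg ^ 2) by (apply pow_lt; lra).
  pose proof PI2_1 as Hpi. pose proof (pow2_ge_0 PI).
  split.
  - assert (E : 4 * (1 + PI / sg) ^ 2 * sg ^ 2 = (2 * sg + 2 * PI) ^ 2) by (field; lra).
    assert (2 * sg + 2 * PI <= L); [| lra].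
    apply Rsqr_incr_0_var; [unfold Rsqr; nra | lra].
  - apply Rsqr_incr_0_var; [unfold Rsqr; nra | lra].
Qed.

(** * Summation over the frequencies *)

Lemma pow_exp (t : R) (n : nat) : exp t ^ n = exp (INR n * t).
Proof.
  induction n as [| n IH]; [simpl; rewrite Rmult_0_l; symmetry; apply exp_0 |].
  rewrite S_INR. simpl. rewrite IH, <- exp_plus. f_equal. ring.
Qed.

(** Twice these terms dominate [1 / n^2], so the sum over frequencies gets an explicit constant. *)
Lemma is_series_telescope : is_series (fun j => / (INR (S j) * INR (S (S j)))) 1.
Proof.
  assert (Hpos : forall n, 0 < INR (S n)) by (intros; apply lt_0_INR; lia).
  assert (Hsum : forall n, sum_n (fun j => / (INR (S j) * INR (S (S j)))) n = 1 - / INR (S (S n))).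
  { intros n; induction n as [| n IH].
    - rewrite sum_O. simpl. field.
    - rewrite sum_Sn, IH.
      change (1 - / INR (S (S n)) + / (INR (S (S n)) * INR (S (S (S n)))) = 1 - / INR (S (S (S n)))).
      pose proof (Hpos (S n)). rewrite (S_INR (S (S n))). field. lra. }
  change (is_lim_seq (sum_n (fun j => / (INR (S j) * INR (S (S j))))) 1).
  apply (is_lim_seq_ext (fun n => 1 - / INR (S (S n)))); [intros; symmetry; apply Hsum |].
  replace (Finite 1) with (Finite (1 - 0)) by (f_equal; ring).
  apply is_lim_seq_minus'; [apply is_lim_seq_const |].
  apply -> (is_lim_seq_incr_1 (fun n => / INR (S n))).
  apply -> (is_lim_seq_incr_1 (fun n => / INR n)).
  replace (Finite 0) with (Rbar_inv p_infty) by reflexivity.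
  apply is_lim_seq_inv; [apply is_lim_seq_INR | discriminate].
Qed.

Lemma is_series_0 : is_series (fun _ : nat => 0) 0.
Proof.
  evar_last; [| apply (Rmult_0_l 1)].
  apply (is_series_ext (fun j => 0 * / (INR (S j) * INR (S (S j)))));
    [intros j; apply Rmult_0_l |].
  apply (is_series_scal (V := R_NormedModule)), is_series_telescope.
Qed.

Lemma is_series_dominated (a b : nat -> R) (s : R) :
  (forall n, Rabs (a n) <= b n) -> is_series b s ->
  exists l, is_series a l /\ Rabs l <= s.
Proof.
  intros Hab Hb.
  assert (Hex : ex_series (fun n => Rabs (a n))).
  { apply (ex_series_le (V := R_CompleteNormedModule)) with b; [| now exists s].
    intros n. unfold norm; simpl. unfold abs; simpl. now rewrite Rabs_Rabsolu. }
  exists (Series a); split; [apply Series_correct, ex_series_Rabs, Hex |].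
  apply Rle_trans with (1 := Series_Rabs a Hex).
  rewrite <- (is_series_unique b s Hb).
  apply Series_le; [| now exists s].
  intros n; split; [apply Rabs_pos | apply Hab].
Qed.

(** Clipping [s] to [[- P, P]] gives the first part. This turns a bound on the whole sum into the
    two separate error terms of the theorem. *)
Lemma Rabs_le_plus_split (s P Q : R) :
  0 <= P -> 0 <= Q -> Rabs s <= P + Q ->
  exists a b, s = a + b /\ Rabs a <= P /\ Rabs b <= Q.
Proof.
  intros HP HQ Hs. apply Rabs_le_between in Hs.
  destruct (Rle_dec s P); [destruct (Rle_dec (- P) s) |].
  - exists s, 0. split; [ring |]. rewrite Rabs_R0. split; [apply Rabs_le; lra | lra].
  - exists (- P), (s + P). split; [ring |]. split; apply Rabs_le; lra.
  - exists P, (s - P). split; [ring |]. split; apply Rabs_le; lra.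
Qed.

Lemma sum_frequencies (a : nat -> R) (K V D r : R) :
  0 <= K -> 0 <= V -> 0 <= D -> 0 < r <= / 2 ->
  (forall j, Rabs (a j) <= K * (V / INR (S j) ^ 2 + D * r ^ S j)) ->
  exists l, is_series a l /\ Rabs l <= 2 * K * V + 2 * K * D * r.
Proof.
  intros HK HV HD Hr Ha.
  destruct (is_series_dominated a
    (fun j => 2 * K * V * / (INR (S j) * INR (S (S j))) + K * D * r * r ^ j)
    (2 * K * V * 1 + K * D * r * / (1 - r))) as [l [Hl1 Hl2]].
  - intros j. apply Rle_trans with (1 := Ha j).
    rewrite Rmult_plus_distr_l. apply Rplus_le_compat; [| right; simpl; ring].
    replace (K * (V / INR (S j) ^ 2)) with (K * V * / INR (S j) ^ 2) by (unfold Rdiv; ring).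
    replace (2 * K * V * / (INR (S j) * INR (S (S j))))
      with (K * V * (2 * / (INR (S j) * INR (S (S j))))) by ring.
    apply Rmult_le_compat_l; [now apply Rmult_le_pos |].
    assert (H1 : 1 <= INR (S j)) by (apply (le_INR 1); lia).
    rewrite (S_INR (S j)). set (n := INR (S j)) in *.
    replace (2 * / (n * (n + 1))) with (/ (n * (n + 1) / 2)) by (field; lra).
    apply Rinv_le_contravar; nra.
  - apply (is_series_plus (V := R_NormedModule)).
    + apply (is_series_scal (V := R_NormedModule)), is_series_telescope.
    + apply (is_series_scal (V := R_NormedModule)), is_series_geom.
      rewrite Rabs_right; lra.
  - exists l; split; [exact Hl1 |]. apply Rle_trans with (1 := Hl2).
    assert (/ (1 - r) <= 2).
    { rewrite <- (Rinv_inv 2). apply Rinv_le_contravar; lra. }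
    assert (0 <= K * D * r) by (repeat apply Rmult_le_pos; lra). nra.
Qed.

(** With [z = al sg], [exp h] is the square of [exp (z^2 / 2)]: one factor absorbs [exp z], the
    other the polynomial in [z]. The remaining [sg^2 exp (sg - L)] is bounded because
    [L >= 2 sg]. *)
Lemma endpoint_part_le (al sg L : R) :
  0 < al < 1 -> 0 < sg -> 2 * sg + 2 <= L ->
  al * (exp (al * sg) * (al * sg ^ 2 + sg ^ 2 * exp (sg - L) + sg))
  <= 20 * exp (sg ^ 2 * al ^ 2).
Proof.
  intros Hal Hsg HL.
  set (z := al * sg). assert (Hz : 0 < z) by (unfold z; nra).
  assert (H1 : sg ^ 2 * exp (sg - L) <= 4).
  { apply Rle_trans with (sg ^ 2 * exp (- sg)).
    - apply Rmult_le_compat_l; [apply pow2_ge_0 | apply exp_le_compat; lra].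
    - rewrite exp_Ropp. pose proof (exp_ge_square sg ltac:(lra)). pose proof (exp_pos sg).
      apply Rmult_le_reg_r with (exp sg); [lra |].
      rewrite Rmult_assoc, Rinv_l by lra. lra. }
  assert (H0 : 0 <= sg ^ 2 * exp (sg - L))
    by (apply Rmult_le_pos; [apply pow2_ge_0 | apply Rlt_le, exp_pos]).
  assert (H2 : al * (al * sg ^ 2 + sg ^ 2 * exp (sg - L) + sg) <= 10 * (1 + z ^ 2 / 2)).
  { replace (al * (al * sg ^ 2 + sg ^ 2 * exp (sg - L) + sg))
      with (z ^ 2 + z + al * (sg ^ 2 * exp (sg - L))) by (unfold z; ring).
    assert (al * (sg ^ 2 * exp (sg - L)) <= 4) by nra. nra. }
  set (E := exp (z ^ 2 / 2)).
  assert (HE : 1 + z ^ 2 / 2 <= E) by apply exp_ge_1_plus.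
  assert (H3 : exp z <= 2 * E).
  { apply Rle_trans with (exp (/ 2 + z ^ 2 / 2)).
    - apply exp_le_compat. pose proof (pow2_ge_0 (z - 1)). nra.
    - rewrite exp_plus. apply Rmult_le_compat_r; [apply Rlt_le, exp_pos |].
      assert (exp (/ 2) * exp (/ 2) <= 3).
      { rewrite <- exp_plus. replace (/ 2 + / 2) with 1 by field. apply exp_le_3. }
      pose proof (exp_pos (/ 2)). nra. }
  replace (sg ^ 2 * al ^ 2) with (z ^ 2 / 2 + z ^ 2 / 2) by (unfold z; field).
  rewrite exp_plus. fold E.
  replace (al * (exp z * (al * sg ^ 2 + sg ^ 2 * exp (sg - L) + sg)))
    with (exp z * (al * (al * sg ^ 2 + sg ^ 2 * exp (sg - L) + sg))) by ring.
  replace (20 * (E * E)) with (2 * E * (10 * E)) by ring.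
  apply Rmult_le_compat; [apply Rlt_le, exp_pos | | exact H3 | lra].
  apply Rmult_le_pos; [lra |]. nra.
Qed.

(* For small [sg] the slope [k] of the contour blows up, but then [q >= 36 L / sg^2]
   is so large that the whole term is bounded. *)
Lemma contour_part_le_small (al sg L : R) :
  0 < al < 1 -> 0 < sg < 1 -> 2 * sg + 2 <= L ->
  al * (2 * PI * (1 + / sg) * exp (al * L)) * exp (- (4 * PI ^ 2 * L / sg ^ 2 - 1)) <= 6.
Proof.
  intros Hal Hsg HL.
  set (q := 4 * PI ^ 2 * L / sg ^ 2).
  pose proof PI2_3_2 as Hpi. pose proof PI_4 as Hpi'.
  set (i := / sg).
  assert (Hi : 1 < i) by (unfold i; rewrite <- Rinv_1 at 1; apply Rinv_lt_contravar; lra).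
  assert (Eq : q = 4 * PI ^ 2 * L * i ^ 2) by (unfold q, i; field; lra).
  assert (Hpi2 : 9 <= PI ^ 2) by nra.
  assert (HqL : 36 * L * i ^ 2 <= q).
  { rewrite Eq. apply Rmult_le_compat_r; [apply pow2_ge_0 | nra]. }
  assert (Hi2 : i <= i ^ 2) by nra.
  assert (Hk : 2 * PI * (1 + i) <= q).
  { apply Rle_trans with (36 * 2 * i); [nra |]. apply Rle_trans with (2 := HqL).
    apply Rmult_le_compat; lra. }
  assert (HL2 : L * 1 <= L * i ^ 2) by (apply Rmult_le_compat_l; lra).
  assert (HLq : al * L <= q / 4) by nra.
  assert (Hq0 : 0 < q) by lra.
  assert (Hq : q <= 2 * exp (q / 2)) by (pose proof (exp_ge_1_plus (q / 2)); lra).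
  (* The slope takes [exp (q / 2)] and [exp (al L)] takes [exp (q / 4)] out of [exp q], so the
     product is at most [2 exp 1]. *)
  apply Rle_trans with (2 * exp (q / 2) * exp (q / 4) * exp (- (q - 1))).
  - apply Rmult_le_compat_r; [apply Rlt_le, exp_pos |].
    apply Rle_trans with (1 * (2 * exp (q / 2) * exp (q / 4))); [| lra].
    pose proof (exp_pos (al * L)).
    assert (0 <= 2 * PI * (1 + i)) by nra.
    apply Rmult_le_compat; [lra | apply Rmult_le_pos; lra | lra |].
    apply Rmult_le_compat; [lra | lra | lra | now apply exp_le_compat].
  - rewrite !Rmult_assoc, <- !exp_plus.
    apply Rle_trans with (2 * exp 1); [| pose proof exp_le_3; lra].
    apply Rmult_le_compat_l; [lra |]. apply exp_le_compat. lra.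
Qed.

(** For [sg >= 1] the slope is at most [4 PI <= 16], and [exp (1 - q)] is at most [3 / (exp q - 1)];
    hence 48. *)
Lemma contour_part_le_large (al sg L : R) :
  0 < al < 1 -> 1 <= sg -> 0 < 4 * PI ^ 2 * L / sg ^ 2 ->
  al * (2 * PI * (1 + / sg) * exp (al * L)) * exp (- (4 * PI ^ 2 * L / sg ^ 2 - 1)) <=
  48 * (exp (al * L) / (exp (4 * PI ^ 2 * L / sg ^ 2) - 1)).
Proof.
  intros Hal Hsg Hq.
  set (q := 4 * PI ^ 2 * L / sg ^ 2) in *.
  pose proof PI_RGT_0 as Hpi. pose proof PI_4 as Hpi'.
  assert (Hi : 0 < / sg <= 1).
  { split; [apply Rinv_0_lt_compat; lra | rewrite <- Rinv_1; apply Rinv_le_contravar; lra]. }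
  assert (Hk : 0 <= al * (2 * PI * (1 + / sg)) <= 16).
  { assert (0 <= 2 * PI * (1 + / sg) <= 16) by (split; nra). split; nra. }
  assert (Hinv : exp (- (q - 1)) <= 3 * / (exp q - 1)).
  { replace (- (q - 1)) with (1 + - q) by ring. rewrite exp_plus, exp_Ropp.
    pose proof (exp_ineq1 q ltac:(lra)).
    apply Rmult_le_compat; [apply Rlt_le, exp_pos | | apply exp_le_3 |].
    - apply Rlt_le, Rinv_0_lt_compat, exp_pos.
    - apply Rinv_le_contravar; lra. }
  pose proof (exp_pos (al * L)). pose proof (exp_pos (- (q - 1))).
  replace (al * (2 * PI * (1 + / sg) * exp (al * L)) * exp (- (q - 1)))
    with (al * (2 * PI * (1 + / sg)) * (exp (al * L) * exp (- (q - 1)))) by ring.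
  replace (48 * (exp (al * L) / (exp q - 1)))
    with (16 * (exp (al * L) * (3 * / (exp q - 1)))) by (unfold Rdiv; ring).
  apply Rmult_le_compat; [lra | nra | lra |].
  apply Rmult_le_compat_l; lra.
Qed.

Theorem theorem3p5 :
  exists C1 C2 : R,
  forall (al sg : R) (N1 : nat),
    0 < al < 1 -> 0 < sg -> (1 < N1)%nat ->
    let h := sg ^ 2 * al ^ 2 in
    let T := sg * al * sqrt (INR N1) in
    forall x : R,
      x_star al T <= x <= 1 ->
      (T + al * ln x) ^ 2 - al ^ 2 * PI ^ 2 > M0 sg * h ->
      let a := 2 * PI * al * (T + al * ln x) in
      let w := fun u => fhat al T h u x in
      (forall n : Z, n <> 0%Z -> fourier_exists w (2 * IZR n * PI / h)) /\
      exists S A B : C,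
        sum_nonzero_is (fun n => fourier w (2 * IZR n * PI / h)) S /\
        S = Cplus A B /\
        Cmod A <= C1 * (exp h * exp (- T)) /\
        Cmod B <= C2 * (Rpower x al / (exp (2 * PI * a / h) - 1)).
Proof.
  (* 8 collects two half-lines, two signs of [n] and the factor 2 of the summation; 800 also
     includes the 100 of the contour. 20, 6 and 48 come from the endpoint, small-[sg] and large-[sg]
     estimates. *)
  exists (8 * 20 + 800 * 6), (800 * 48).
  intros al sg N1 Hal Hsg _ h T x Hx HM a w.
  assert (Hx0 : 0 < x) by (apply Rlt_le_trans with (2 := proj1 Hx), exp_pos).
  destruct (scaled_height_bounds al sg T x Hal Hsg (proj1 Hx) HM) as [HL HL2].
  pose proof (fourier_fhat al sg T x Hal Hsg Hx0 HL HL2) as HF.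
  set (L := (T + al * ln x) / al) in *.
  change (sg ^ 2 * al ^ 2) with h in HF.
  split; [intros n Hn; apply (HF n Hn) |].
  pose proof (decay_rate_ge sg L Hsg HL2) as Hq.
  set (q := 4 * PI ^ 2 * L / sg ^ 2) in *.
  set (V := exp (al * sg) * (al * sg ^ 2 + sg ^ 2 * exp (sg - L) + sg)) in *.
  set (k := 2 * PI * (1 + / sg)) in *.
  pose proof PI_RGT_0 as Hpi.
  assert (Hk : 0 < k).
  { unfold k. pose proof (Rinv_0_lt_compat _ Hsg). nra. }
  assert (HeT : 0 < exp (- T)) by apply exp_pos.
  assert (HV : 0 <= V).
  { unfold V. pose proof (exp_pos (al * sg)). pose proof (exp_pos (sg - L)).
    pose proof (pow2_ge_0 sg). apply Rmult_le_pos; [lra |]. nra. }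
  destruct (sum_frequencies
    (fun j => fourier_re w (2 * IZR (Z.of_nat (S j)) * PI / h)
              + fourier_re w (2 * IZR (- Z.of_nat (S j)) * PI / h))
    (4 * (al * exp (- T))) V (100 * k * exp (al * L)) (exp (- (q - 1))))
    as [l [Hl1 Hl2]].
  - nra.
  - exact HV.
  - pose proof (exp_pos (al * L)). apply Rmult_le_pos; lra.
  - split; [apply exp_pos | apply exp_neg_le_half; lra].
  - intros j.
    assert (Hpow : exp (- (q - 1)) ^ S j = exp (- (INR (S j) * (q - 1)))).
    { rewrite pow_exp. f_equal. ring. }
    apply Rle_trans with (1 := Rabs_triang _ _).
    destruct (HF (Z.of_nat (S j)) ltac:(lia)) as [_ [_ H1]].
    destruct (HF (- Z.of_nat (S j))%Z ltac:(lia)) as [_ [_ H2]].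
    replace (Z.abs_nat (Z.of_nat (S j))) with (S j) in H1 by lia.
    replace (Z.abs_nat (- Z.of_nat (S j))) with (S j) in H2 by lia.
    fold w in H1, H2.
    replace (al * L - INR (S j) * (q - 1)) with (al * L + - (INR (S j) * (q - 1))) in H1, H2 by ring.
    rewrite exp_plus, <- Hpow in H1, H2. nra.
  - set (X := exp (al * L) / (exp q - 1)).
    assert (HX : 0 < X).
    { apply Rdiv_lt_0_compat; [apply exp_pos |]. pose proof (exp_ineq1 q ltac:(lra)). lra. }
    (* [al L = T + al ln x] gives [x^al = exp (- T) exp (al L)], so both error terms share the
       factor [exp (- T)]. *)
    assert (EX : Rpower x al / (exp (2 * PI * a / h) - 1) = exp (- T) * X).
    { unfold X, Rpower. replace (2 * PI * a / h) with q
        by (unfold q, a, h, L; field; lra).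
      unfold Rdiv. rewrite <- Rmult_assoc, <- exp_plus. do 2 f_equal. unfold L. field. lra. }
    rewrite EX.
    assert (Hh : 1 <= exp h).
    { rewrite <- exp_0. apply exp_le_compat. unfold h.
      apply Rmult_le_pos; apply pow2_ge_0. }
    pose proof (endpoint_part_le al sg L Hal Hsg HL) as HA. fold V h in HA.
    assert (Hsplit : Rabs l <= (8 * 20 + 800 * 6) * (exp h * exp (- T))
                               + 800 * 48 * (exp (- T) * X)).
    { apply Rle_trans with (1 := Hl2).
      set (W := al * (k * exp (al * L)) * exp (- (q - 1))).
      assert (HW : W <= 6 * exp h + 48 * X).
      { destruct (Rlt_dec sg 1) as [Hs | Hs].
        - pose proof (contour_part_le_small al sg L Hal (conj Hsg Hs) HL) as H.
          fold k q W in H. lra.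
        - pose proof (contour_part_le_large al sg L Hal ltac:(lra) ltac:(fold q; lra)) as H.
          fold k q W X in H. lra. }
      replace (2 * (4 * (al * exp (- T))) * V +
               2 * (4 * (al * exp (- T))) * (100 * k * exp (al * L)) * exp (- (q - 1)))
        with (exp (- T) * (8 * (al * V) + 800 * W)) by (unfold W; ring).
      replace ((8 * 20 + 800 * 6) * (exp h * exp (- T)) + 800 * 48 * (exp (- T) * X))
        with (exp (- T) * (8 * (20 * exp h) + 800 * (6 * exp h + 48 * X))) by ring.
      apply Rmult_le_compat_l; lra. }
    apply Rabs_le_plus_split in Hsplit.
    + destruct Hsplit as [A [B [E [HA' HB']]]].
      exists (RtoC l), (RtoC A), (RtoC B).
      split; [split |].
      * exact Hl1.
      * apply (is_series_ext (fun _ => 0)); [| exact is_series_0].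
        intros j.
        change (0 = fourier_im w (2 * IZR (Z.of_nat (S j)) * PI / h)
                    + fourier_im w (2 * IZR (- Z.of_nat (S j)) * PI / h)).
        destruct (HF (Z.of_nat (S j)) ltac:(lia)) as [_ [H1 _]].
        destruct (HF (- Z.of_nat (S j))%Z ltac:(lia)) as [_ [H2 _]].
        fold w in H1, H2. rewrite H1, H2. ring.
      * rewrite !Cmod_R. repeat split; trivial. now rewrite E, RtoC_plus.
    + apply Rmult_le_pos; nra.
    + apply Rmult_le_pos; nra.
Qed.
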